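(* There exist a compact Hausdorff space $K$, a Banach space $Y$ and a linear operator $T:C(K)\to Y$ such that $T$ has (Rademacher) cotype $2$, but $T$ does not factor through a Hilbert space.
   Context: $C(K)$ is the Banach space of continuous functions on the compact Hausdorff space $K$ with the supremum norm. Let $\varepsilon_1,\varepsilon_2,\ldots$ be independent Rademacher random variables: $\Pr(\varepsilon_s=1)=\Pr(\varepsilon_s=-1)=\frac12$. A linear operator $T:X\to Y$ between Banach spaces has (Rademacher) cotype $2$ if there is a constant $C<\infty$ such that for every finite family $x_1,\ldots,x_S\in X$ $$\Big(\sum_{s=1}^S\|T(x_s)\|^2\Big)^{1/2}\le C\,\mathbb{E}\Big\|\sum_{s=1}^S\varepsilon_s x_s\Big\|.$$ $T$ factors through a Hilbert space if $T=BA$ for some Hilbert space $H$ and bounded linear operators $A:X\to H$, $B:H\to Y$. *)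

(* Defs.v *)
From HB Require Import structures.
From mathcomp Require Import all_boot all_order all_algebra finmap.
From mathcomp Require Import sesquilinear ring.
From mathcomp Require Import all_classical all_reals all_analysis.

Set Implicit Arguments.
Unset Strict Implicit.
Unset Printing Implicit Defensive.

Import Order.TTheory GRing.Theory Num.Theory.
Import numFieldNormedType.Exports.

Local Open Scope classical_set_scope.
Local Open Scope ring_scope.

(* The Banach space C(K). Compactness of K is a parameter of the type, since it
   is what makes the supremum norm (and hence the normed-module instances
   below) well defined. *)
Definition CK (R : realType) (K : topologicalType) (cK : compact [set: K]) :
  Type := continuousType K R.

Section CK_lmodule.
Context (R : realType) (K : topologicalType) (cK : compact [set: K]).

Lemma CK_cts (f : CK R cK) : continuous (f : K -> R).
Proof. exact: cts_fun. Qed.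

Definition CK_pred : {pred K -> R} := mem [set f : K -> R | continuous f].

Definition CK_Sub (f : K -> R) (fP : f \in CK_pred) : CK R cK :=
  [the continuousType K R of mkcts (set_mem fP : continuous f)].

Lemma CK_rect (Q : CK R cK -> Type) :
  (forall f (fP : f \in CK_pred), Q (CK_Sub fP)) -> forall u, Q u.
Proof.
move=> QS u.
have uP : (u : K -> R) \in CK_pred by rewrite inE; exact: CK_cts.
suff -> : u = CK_Sub uP by exact: QS.
by apply/continuousEP.
Qed.

Lemma CK_SubK (f : K -> R) (fP : f \in CK_pred) : (CK_Sub fP : K -> R) = f.
Proof. by []. Qed.

HB.instance Definition _ := isSub.Build _ _ (CK R cK) CK_rect CK_SubK.
HB.instance Definition _ := [Choice of CK R cK by <:].

Lemma CK_submod_closed : submod_closed CK_pred.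
Proof.
split; first by rewrite inE /= => x; exact: cvg_cst.
move=> a f g; rewrite !inE /= => cf cg x.
by apply: cvgD; [apply: cvgZr; exact: cf|exact: cg].
Qed.

HB.instance Definition _ := GRing.isSubmodClosed.Build R (K -> R) CK_pred
  CK_submod_closed.
HB.instance Definition _ := [SubChoice_isSubLmodule of CK R cK by <:].

End CK_lmodule.

Section CK_normed.
Context (R : realType) (K : topologicalType) (cK : compact [set: K]).
Implicit Types f g : CK R cK.

(* For empty K this is sup set0 = 0. *)
Definition CK_norm f : R := sup (range (fun x => `|f x|)).

Lemma CK_has_ubound f : has_ubound (range (fun x => `|f x|)).
Proof.
have cf : {within [set: K], continuous (f : K -> R)}.
  by apply: continuous_subspaceT; exact: CK_cts.
have /compact_bounded[M [_ fM]] := continuous_compact cf cK.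
exists (M + 1) => _ [x _ <-]; apply: (fM (M + 1)); first by rewrite ltrDl.
by exists x.
Qed.

Lemma CK_norm_ub f x : `|f x| <= CK_norm f.
Proof. by apply: ub_le_sup; [exact: CK_has_ubound|exists x]. Qed.

Lemma CK_norm_ge0 f : 0 <= CK_norm f.
Proof.
have [[x _]|K0] := pselect ([set: K] !=set0).
  exact: le_trans (normr_ge0 (f x)) (CK_norm_ub f x).
rewrite /CK_norm (_ : [set `|f x| | x in _] = set0) ?sup0//.
by rewrite -subset0 => y [x _ _]; apply: K0; exists x.
Qed.

Lemma CK_norm_le f (e : R) : 0 <= e -> (forall x, `|f x| <= e) ->
  CK_norm f <= e.
Proof.
move=> e0 fe; have [[x _]|K0] := pselect ([set: K] !=set0).
  by apply: ge_sup => [|_ [y _ <-]//]; exists `|f x|; exists x.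
rewrite /CK_norm (_ : [set `|f x| | x in _] = set0) ?sup0//.
by rewrite -subset0 => y [x _ _]; apply: K0; exists x.
Qed.

Lemma CK_normD f g : CK_norm (f + g) <= CK_norm f + CK_norm g.
Proof.
apply: CK_norm_le => [|x]; first by rewrite addr_ge0 ?CK_norm_ge0.
by rewrite (le_trans (ler_normD _ _)) ?lerD ?CK_norm_ub.
Qed.

Lemma CK_normZ (a : R) f : CK_norm (a *: f) = `|a| * CK_norm f.
Proof.
have le b g : CK_norm (b *: g) <= `|b| * CK_norm g.
  apply: CK_norm_le => [|x]; first by rewrite mulr_ge0 ?CK_norm_ge0.
  by rewrite [(b *: g) x]/(b * g x) normrM ler_wpM2l ?CK_norm_ub.
apply/eqP; rewrite eq_le le/=.
have [->|a0] := eqVneq a 0; first by rewrite normr0 mul0r CK_norm_ge0.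
rewrite -ler_pdivlMl ?normr_gt0// -normfV.
by rewrite -[in leLHS](scalerK a0 f) le.
Qed.

Lemma CK_norm0_eq0 f : CK_norm f = 0 -> f = 0.
Proof.
move=> f0; apply: val_inj; apply/funext => x.
by apply/eqP; rewrite -normr_le0 -f0 CK_norm_ub.
Qed.

HB.instance Definition _ := Lmodule_isNormed.Build R (CK R cK)
  CK_normD CK_normZ CK_norm0_eq0.

Lemma CK_normE f : `|f| = CK_norm f. Proof. by []. Qed.

Lemma CK_complete (F : set_system (CK R cK)) : ProperFilter F ->
  cauchy F -> cvg F.
Proof.
move=> FF Fc.
pose close (e : R) (f g : CK R cK) := forall x, `|f x - g x| <= e.
have Fd (e : R) : 0 < e -> \forall f \near F, \forall g \near F, close e f g.
  move=> e0; apply: nearP_dep; have /cauchy_ballP/(_ e e0) := Fc.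
  apply: filterS => -[f g] /=; rewrite -ball_normE/= => /ltW fg x.
  by apply: le_trans fg; exact: (CK_norm_ub (f - g) x).
have cvx x : cvg ((fun f : CK R cK => f x) @ F).
  apply: cauchy_cvg; apply: cauchy_exP => e e0.
  have [f] := filter_ex (Fd _ (divr_gt0 e0 (ltr0n R 2))).
  move=> fF; exists (f x); apply: filterS fF => g fg.
  rewrite -ball_normE/=; apply: le_lt_trans (fg x) _.
  by rewrite ltr_pdivrMr// ltr_pMr// ltr1n.
pose l x : R := lim ((fun f : CK R cK => f x) @ F).
have Fl (e : R) : 0 < e -> \forall f \near F, forall x, `|(f : CK R cK) x - l x| <= e.
  move=> e0; have := Fd _ e0; apply: filterS => f fF x.
  have cfl : (fun g : CK R cK => `|f x - g x|) @ F --> `|f x - l x|.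
    by apply: cvg_norm; apply: cvgB; [exact: cvg_cst|exact: cvx].
  apply: (closed_cvg (fun y : R => y <= e)) cfl; first exact: closed_le.
  by apply: filterS fF => g; exact.
have lc : continuous l.
  move=> x; apply/cvgrPdist_le => e e0.
  have e3 : 0 < e / 3 by rewrite divr_gt0.
  have [f fl] := filter_ex (Fl _ e3).
  have /cvgrPdist_le/(_ _ e3) fx := @CK_cts R K cK f x.
  apply: filterS fx => y fxy.
  rewrite (_ : l x - l y = (l x - f x) + (f x - f y) + (f y - l y));
    last by ring.
  rewrite (_ : e = e / 3 + e / 3 + e / 3); last by field.
  apply: le_trans (ler_normD _ _) (lerD _ (fl y)).
  by apply: le_trans (ler_normD _ _) (lerD _ fxy); rewrite distrC.
apply/cvg_ex; exists ([the continuousType K R of mkcts lc] : CK R cK).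
apply/cvgrPdist_le => e e0.
have := Fl _ e0; apply: filterS => f fl.
rewrite CK_normE; apply: CK_norm_le => [|x]; first exact: ltW.
by rewrite -[(_ - f) x]/(l x - f x) distrC. Qed.

HB.instance Definition _ := Uniform_isComplete.Build (CK R cK) CK_complete.

End CK_normed.

Section operators.
Context (R : realType).

Definition bounded_operator (X Y : normedModType R) (A : {linear X -> Y}) :=
  exists M : R, forall x, `|A x| <= M * `|x|.

Definition is_hilbert (H : completeNormedModType R) :=
  exists dot : {dot H for idfun}, forall u : H, `|u| ^+ 2 = dot u u.

Definition factors_through_hilbert (X Y : completeNormedModType R)
    (T : {linear X -> Y}) :=
  exists (H : completeNormedModType R)
         (A : {linear X -> H}) (B : {linear H -> Y}),
    [/\ is_hilbert H, bounded_operator A, bounded_operator B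
      & forall x, T x = B (A x)].

End operators.

Section rademacher.
Context (R : realType) (d : measure_display) (Omega : measurableType d)
        (P : probability Omega R).

Definition mutually_independent (I : choiceType)
    (X : I -> {RV P >-> R}) :=
  forall (J : {fset I}) (A : I -> set R), (forall i, measurable (A i)) ->
    P (\bigcap_(i in [set` J]) (X i @^-1` A i)) =
    (\prod_(i <- J) P (X i @^-1` A i))%E.

Definition is_rademacher (X : {RV P >-> R}) :=
  P [set w | X w = 1] = (1 / 2)%:E /\ P [set w | X w = -1] = (1 / 2)%:E.

Definition rademacher_sequence (eps : nat -> {RV P >-> R}) :=
  mutually_independent eps /\ forall s, is_rademacher (eps s).

End rademacher.

(* The joint law of a Rademacher sequence is determined, so the expectation does
   not depend on the probability space carrying it; the sequence eps 0, eps 1,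
   ... is indexed from 0. Boundedness of T is the case S = 1. *)
Definition has_cotype2 (R : realType) (X Y : completeNormedModType R)
    (T : {linear X -> Y}) :=
  exists C : R, forall (d : measure_display) (Omega : measurableType d)
      (P : probability Omega R) (eps : nat -> {RV P >-> R}),
    rademacher_sequence eps ->
    forall (S : nat) (x : 'I_S -> X),
    ((Num.sqrt (\sum_(s < S) `|T (x s)| ^+ 2))%:E <=
      C%:E * 'E_P[(fun w => `| \sum_(s < S) eps s w *: x s |)%R])%E.

(* Main.v *)
Require Import Defs.
From HB Require Import structures.
From mathcomp Require Import all_boot all_order all_algebra.
From mathcomp Require finmap.
From mathcomp Require Import all_classical all_reals all_analysis.
From mathcomp Require Import ring lra.

(** The operator samples a function on larger and larger finite sets and measures
    each sample in the Lorentz norm L_(2,1) of the uniform probability, that is, by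
    pairing it with the weights of [weak_l2]. The block of size N enters with a weight
    a, and the target is a space of bounded functions, indexed by all blocks and
    weights. Write h for the harmonic sum of length N, which is about log N; it is, up
    to constants, the largest squared ratio of the L_(2,1) and L_2 norms on N points.

    Hilbert space. If the operator factored, [little_grothendieck] would make it
    2-summing, with one constant for all blocks. The translates of 1 / sqrt (i + 1) over
    a cyclic group of order N have the constant square function h, whereas the
    squares of their Lorentz norms add up to at least h^2 / 4. Hence the
    factorization fails as soon as a^2 h is unbounded over the blocks.

    Cotype 2. Let x_s be functions on a block such that the mean of the supremum of
    their signed sums is at most 1, and view each point t as the vector
    (x_s(t))_s. Three kinds of vectors are harmless for the sum of the squared
    Lorentz norms: vectors bounded by L in l_1 contribute at most L^2, as the
    embedding into L_(2,1) is (2,1)-summing; vectors bounded by u in l_2 contribute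
    at most u^2 h; and vectors ranging over M values contribute at most 3 M, for any
    N. So it is enough that, for every u > 0, the vectors are covered by M translates
    of u B_2 + L B_1, where M and L depend on u only. Then the constant of the block
    is at most 3 (u^2 h + F(u)) by [block_cotype]; as u is arbitrary, this is o(h), and
    the blocks can be weighted so that a^2 h is unbounded while the a^2 (u^2 h + F(u))
    have a finite sum ([block_parameters]).

    The covering is a qualitative Sudakov minoration for signed sums. Clipping the
    coordinates at a small height c changes the vectors by at most 3 / c in l_1, and
    by [contraction_principle] it does not increase the mean of the supremum. If
    too many clipped vectors were u-separated in l_2, a descent argument
    ([energy_descent]) would find a centre from which most pairs among many of them
    look almost orthogonal. The Riesz products of these centred vectors, scaled by
    a large factor, are densities with nearly uncorrelated values, so that their
    average keeps a proportion of its mass on the event where all signed sums are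
    bounded; but each of these densities is tiny there ([near_orthogonal_false]). *)

Set Implicit Arguments.
Unset Strict Implicit.
Unset Printing Implicit Defensive.

Import Order.TTheory GRing.Theory Num.Theory.
Import numFieldNormedType.Exports.

Local Open Scope classical_set_scope.
Local Open Scope ring_scope.

(** * Averages over sign vectors *)

Section sign_averages.
Context (R : realType) (I : finType).
Implicit Types (f g : {ffun I -> bool} -> R) (s : {ffun I -> bool}).

Definition smean f : R := (\sum_s f s) / 2 ^+ #|I|.

Definition sgn (b : bool) : R := (-1) ^+ b.

Lemma sgnN b : sgn (~~ b) = - sgn b.
Proof. by rewrite /sgn signrN. Qed.

Lemma sgn_sqr b : sgn b ^+ 2 = 1.
Proof. by rewrite /sgn sqrr_sign. Qed.

Lemma le_smean f g : (forall s, f s <= g s) -> smean f <= smean g.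
Proof. by move=> fg; rewrite ler_pM2r ?invr_gt0 ?exprn_gt0// ler_sum. Qed.

Lemma smeanD f g : smean (fun s => f s + g s) = smean f + smean g.
Proof. by rewrite /smean big_split/= mulrDl. Qed.

Lemma smeanZ (a : R) f : smean (fun s => a * f s) = a * smean f.
Proof. by rewrite /smean -mulr_sumr mulrA. Qed.

Lemma smeanB f g : smean (fun s => f s - g s) = smean f - smean g.
Proof. by rewrite /smean sumrB mulrBl. Qed.

Lemma smean_sum (J : Type) (r : seq J) (P : pred J) (F : J -> {ffun I -> bool} -> R) :
  smean (fun s => \sum_(j <- r | P j) F j s) = \sum_(j <- r | P j) smean (F j).
Proof. by rewrite /smean exchange_big/= mulr_suml. Qed.

Lemma card_signs : #|{ffun I -> bool}|%:R = 2 ^+ #|I| :> R.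
Proof. by rewrite card_ffun card_bool natrX. Qed.

Lemma smean_cst (a : R) : smean (fun=> a) = a.
Proof.
by rewrite /smean sumr_const -[a *+ _]mulr_natr card_signs mulfK ?expf_neq0.
Qed.

Lemma smean_ge0 f : (forall s, 0 <= f s) -> 0 <= smean f.
Proof. by move=> f0; rewrite -(smean_cst 0) le_smean. Qed.

Lemma smean_prod (F : I -> bool -> R) :
  smean (fun s => \prod_i F i (s i)) = \prod_i ((F i true + F i false) / 2).
Proof.
rewrite big_split/= prodr_const exprVn; congr (_ * _).
under [RHS]eq_bigr do rewrite -big_bool.
by rewrite bigA_distr_bigA.
Qed.

Definition sflip (i : I) s : {ffun I -> bool} :=
  [ffun j => if j == i then ~~ s j else s j].

Lemma sflipK i : involutive (sflip i).
Proof.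
by move=> s; apply/ffunP => j; rewrite !ffunE; case: eqP => // _; rewrite negbK.
Qed.

Lemma smean_flip i f : smean (fun s => f (sflip i s)) = smean f.
Proof.
rewrite /smean [in RHS](reindex_inj (inv_inj (sflipK i))).
by congr (_ / _); apply: eq_bigl.
Qed.

(** Signs are averaged out one at a time: it suffices to compare the sums of the
    two values obtained by flipping a single coordinate. *)
Lemma smean_flip_le i f g :
  (forall s, f s + f (sflip i s) <= g s + g (sflip i s)) -> smean f <= smean g.
Proof.
move=> fg; have := le_smean fg; rewrite !smeanD !smean_flip.
lra.
Qed.

Lemma smean_flip_eq i f g :
  (forall s, f s + f (sflip i s) = g s + g (sflip i s)) -> smean f = smean g.
Proof.
move=> fg; apply: le_anti.
by rewrite (@smean_flip_le i f g) ?(@smean_flip_le i g f)// => s; rewrite fg.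
Qed.

Lemma sgn_flip i s : sgn (sflip i s i) = - sgn (s i).
Proof. by rewrite ffunE eqxx sgnN. Qed.

Lemma sgn_flip_neq i j s : j != i -> sgn (sflip i s j) = sgn (s j).
Proof. by move=> ji; rewrite ffunE (negbTE ji). Qed.

(** Adding one signed vector at a time, the two choices of the new sign are
    averaged by the parallelogram law. Applied to squares of reals and to the
    squared norm of a Hilbert space, this is orthogonality of the signs. *)
Lemma smean_parallelogram (V : lmodType R) (Q : V -> R) (h : I -> V) :
    Q 0 = 0 -> (forall u v, Q (u + v) + Q (u - v) = 2 * Q u + 2 * Q v) ->
  smean (fun s => Q (\sum_i sgn (s i) *: h i)) = \sum_i Q (h i).
Proof.
move=> Q0 QP.
have QN u : Q (- u) = Q u by have := QP 0 u; rewrite add0r sub0r Q0; lra.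
have: uniq (index_enum I) by exact: index_enum_uniq.
elim: index_enum => [|i r IH]/=.
  by move=> _; under eq_fun do rewrite big_nil; rewrite smean_cst Q0 big_nil.
move=> /andP[ir ur]; rewrite [RHS]big_cons -IH// addrC -[X in _ + X]smean_cst.
rewrite -smeanD; apply: (@smean_flip_eq i) => s.
rewrite !big_cons sgn_flip.
have -> : \sum_(j <- r) sgn (sflip i s j) *: h j = \sum_(j <- r) sgn (s j) *: h j.
  by apply: eq_big_seq => j jr; rewrite sgn_flip_neq//; apply: contraNneq ir => <-.
set u := \sum_(j <- r) _; have [->|->] : sgn (s i) = 1 \/ sgn (s i) = -1.
- by rewrite /sgn; case: (s i); [right|left]; rewrite ?expr1 ?expr0.
- by rewrite scale1r scaleN1r addrC [- _ + _]addrC [h i + _]addrC addrC QP; lra.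
- by rewrite opprK scale1r scaleN1r addrC [- _ + _]addrC [h i + _]addrC QP; lra.
Qed.

Definition rad (a : I -> R) s : R := \sum_i sgn (s i) * a i.

Lemma smean_rad2 (a : I -> R) :
  smean (fun s => rad a s ^+ 2) = \sum_i a i ^+ 2.
Proof.
rewrite -(@smean_parallelogram R^o (fun x => x ^+ 2))//; first exact: expr0n.
by move=> u v; ring.
Qed.

(** Odd powers of a new sign average out, so one more coefficient a turns the
    fourth moment X_4 into X_4 + 6 a^2 X_2 + a^4. *)
Lemma smean_rad4 (a : I -> R) :
  smean (fun s => rad a s ^+ 4) <= 3 * (\sum_i a i ^+ 2) ^+ 2.
Proof.
rewrite /rad.
suff [] : smean (fun s => (\sum_i sgn (s i) * a i) ^+ 4) <= 3 * (\sum_i a i ^+ 2) ^+ 2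
  /\ smean (fun s => (\sum_i sgn (s i) * a i) ^+ 2) = \sum_i a i ^+ 2 by [].
have: uniq (index_enum I) by exact: index_enum_uniq.
elim: index_enum => [|i r IH]/=.
  move=> _; under eq_fun do rewrite big_nil expr0n/=.
  under [X in _ /\ smean X = _]eq_fun do rewrite big_nil expr0n/=.
  by rewrite !smean_cst !big_nil; split => //; rewrite expr0n mulr0.
move=> /andP[ir ur]; have [IH4 IH2] := IH ur.
have flip s : \sum_(j <- r) sgn (sflip i s j) * a j = \sum_(j <- r) sgn (s j) * a j.
  by apply: eq_big_seq => j jr; rewrite sgn_flip_neq//; apply: contraNneq ir => <-.
rewrite !big_cons; split; last first.
  rewrite -IH2 -[X in X + _]smean_cst -smeanD; apply: (@smean_flip_eq i) => s.
  rewrite !big_cons flip sgn_flip; have := sgn_sqr (s i).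
  set u := \sum_(j <- r) _; set e := sgn _ => e2.
  transitivity (2 * (u ^+ 2 + e ^+ 2 * a i ^+ 2)); first by ring.
  by rewrite e2; ring.
rewrite (@smean_flip_eq i _ (fun s => (\sum_(j <- r) sgn (s j) * a j) ^+ 4 +
    (6 * a i ^+ 2 * (\sum_(j <- r) sgn (s j) * a j) ^+ 2 + a i ^+ 4))); last first.
  move=> s; rewrite !big_cons flip sgn_flip; have := sgn_sqr (s i).
  set u := \sum_(j <- r) _; set e := sgn _ => e2.
  transitivity (2 * (u ^+ 4 + 6 * (e ^+ 2) * a i ^+ 2 * u ^+ 2 +
    (e ^+ 2) ^+ 2 * a i ^+ 4)); first by ring.
  by rewrite e2; ring.
rewrite !smeanD smeanZ smean_cst IH2.
have := IH4; set X := smean _; set V := \sum_(j <- r) _; set A := a i => IH4'.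
have : 0 <= A ^+ 4 by rewrite (_ : 4%N = (2 * 2)%N)// exprM sqr_ge0.
rewrite (_ : 3 * (A ^+ 2 + V) ^+ 2 = 3 * V ^+ 2 + 6 * A ^+ 2 * V + 3 * A ^+ 4); last by ring.
lra.
Qed.

(** The first absolute moment controls the second one because the fourth does:
    with y = |x|, the difference of the two sides of the inequality [key] below is
    y (y - r)^2 (y + 2 r). *)
Lemma khintchine (a : I -> R) (m : R) :
  smean (fun s => `|rad a s|) <= m -> \sum_i a i ^+ 2 <= 3 * m ^+ 2.
Proof.
move=> am; set V := \sum_i _.
have m0 : 0 <= m by apply: le_trans am; exact: smean_ge0.
have [V0|V0] := leP V 0; first by rewrite (le_trans V0)// mulr_ge0 ?sqr_ge0.
(* This r maximizes the lower bound for the first moment that key gives. *)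
pose r := Num.sqrt (3 * V).
have r2 : r ^+ 2 = 3 * V by rewrite sqr_sqrtr//; lra.
have r0 : 0 < r by rewrite sqrtr_gt0; lra.
have key x : 3 * r ^+ 2 * x ^+ 2 - x ^+ 4 <= 2 * r ^+ 3 * `|x|.
  rewrite (_ : x ^+ 2 = `|x| ^+ 2); last by rewrite real_normK// num_real.
  rewrite (_ : x ^+ 4 = `|x| ^+ 4); last first.
    by rewrite -normrX ger0_norm// (_ : 4%N = (2 * 2)%N)// exprM sqr_ge0.
  have y0 := normr_ge0 x; set y := `|x| in y0 *.
  rewrite -subr_ge0 (_ : _ - _ = y * ((y - r) ^+ 2 * (y + 2 * r))); last by ring.
  by apply: mulr_ge0 => //; apply: mulr_ge0; [exact: sqr_ge0|move: y0 r0; lra].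
have := le_smean (fun s => key (rad a s)).
rewrite smeanB !smeanZ smean_rad2 -/V r2 => h.
have h4 := smean_rad4 a; rewrite -/V in h4.
have h' : 2 * (3 * V ^+ 2) <= 2 * (3 * V * r * m).
  have : r ^+ 3 * smean (fun s => `|rad a s|) <= r ^+ 3 * m.
    by rewrite ler_wpM2l// exprn_ge0// ltW.
  rewrite [r ^+ 3]exprSr r2.
  move: h; rewrite [2 * r ^+ 3 * _]mulrC (_ : r ^+ 3 = 3 * V * r); last first.
    by rewrite -r2 exprSr.
  nra.
have : V <= r * m.
  rewrite -(ler_pM2l V0) -expr2 -(ler_pM2l (ltr0n R 6)).
  by move: h'; rewrite -!mulrA !mulrA; lra.
move=> Vrm; have : V ^+ 2 <= 3 * V * m ^+ 2.
  by rewrite -r2 -exprMn lerXn2r ?nnegrE ?mulr_ge0// ltW.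
rewrite expr2 -mulrA [3 * (V * _)]mulrCA ler_pM2l//.
Qed.

End sign_averages.

(** * Contraction principle and truncation *)

Section contraction.
Context (R : realType) (I : finType).

Let signmax (J : finType) (j0 : J) (a : J -> I -> R) (s : {ffun I -> bool}) : R :=
  \big[Num.max/rad (a j0) s]_j rad (a j) s.

Let signmax_ge (J : finType) (j0 j : J) a s : rad (a j) s <= signmax j0 a s.
Proof. exact: (le_bigmax _ (fun i => rad (a i) s)). Qed.

Let signmax_attained (J : finType) (j0 : J) a s :
  exists j, signmax j0 a s = rad (a j) s.
Proof.
rewrite /signmax; elim/big_ind: _ => [|x y [j ->] [k ->]|j _].
- by exists j0.
- by rewrite maxElt; case: ifP => _; [exists k|exists j].
- by exists j.
Qed.

(** For two opposite signs at i0, the maxima of the contracted process are attained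
    at some j and k; the maxima of the original one at (j, k) or at (k, j),
    according to the sign of a j i0 - a k i0, are larger. *)
Let contraction1 (J : finType) (j0 : J) (i0 : I) (a a' : J -> I -> R) :
    (forall j i, i != i0 -> a' j i = a j i) ->
    (forall j k, `|a' j i0 - a' k i0| <= `|a j i0 - a k i0|) ->
  smean (signmax j0 a') <= smean (signmax j0 a).
Proof.
move=> aa' lip; apply: (@smean_flip_le _ _ i0) => s.
have [j ->] := signmax_attained j0 a' s.
have [k ->] := signmax_attained j0 a' (sflip i0 s).
pose rest j := \sum_(i | i != i0) sgn R (s i) * a j i.
have radE l : rad (a l) s = sgn R (s i0) * a l i0 + rest l by rewrite /rad (bigD1 i0).
have radE' l : rad (a' l) s = sgn R (s i0) * a' l i0 + rest l.
  rewrite /rad (bigD1 i0)//=; congr (_ + _).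
  by apply: eq_bigr => i ii0; rewrite aa'.
have radF l : rad (a l) (sflip i0 s) = - (sgn R (s i0) * a l i0) + rest l.
  rewrite /rad (bigD1 i0)//= sgn_flip mulNr; congr (_ + _).
  by apply: eq_bigr => i ii0; rewrite sgn_flip_neq.
have radF' l : rad (a' l) (sflip i0 s) = - (sgn R (s i0) * a' l i0) + rest l.
  rewrite /rad (bigD1 i0)//= sgn_flip mulNr; congr (_ + _).
  by apply: eq_bigr => i ii0; rewrite sgn_flip_neq// aa'.
have := lip j k; have := signmax_ge j0 j a s; have := signmax_ge j0 k a s.
have := signmax_ge j0 j a (sflip i0 s); have := signmax_ge j0 k a (sflip i0 s).
rewrite radE' radF' !radE !radF.
have [-> | ->] : sgn R (s i0) = 1 \/ sgn R (s i0) = -1.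
- by rewrite /sgn; case: (s i0); [right|left]; rewrite ?expr1 ?expr0.
- move=> h1 h2 h3 h4 /ler_normlP[h5 h6].
  by have [h|h] := lerP 0 (a j i0 - a k i0);
    move: h5 h6; rewrite ?(ger0_norm h) ?(ltr0_norm h); lra.
- move=> h1 h2 h3 h4 /ler_normlP[h5 h6].
  by have [h|h] := lerP 0 (a j i0 - a k i0);
    move: h5 h6; rewrite ?(ger0_norm h) ?(ltr0_norm h); lra.
Qed.

(** As phi is odd, absolute values are maxima over the symmetrized index set
    T * bool, on which the coordinates are contracted one after the other. The
    majorants B and B' stand for the suprema of the processes. *)
Lemma contraction_principle (T : finType) (t : T -> I -> R) (phi : R -> R)
    (B : {ffun I -> bool} -> R) :
    (forall x y, `|phi x - phi y| <= `|x - y|) -> (forall x, phi (- x) = - phi x) ->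
    (forall j s, `|rad (t j) s| <= B s) ->
  exists2 B' : {ffun I -> bool} -> R,
    forall j s, `|rad (phi \o t j) s| <= B' s & smean B' <= smean B.
Proof.
move=> lip odd tB; have [j0 _|T0] := pickP (@predT T); last first.
  by exists B => // j; have := T0 j.
pose a (r : seq I) (jb : T * bool) i : R :=
  let x := sgn R jb.2 * t jb.1 i in if i \in r then phi x else x.
have step r : smean (signmax (j0, false) (a r)) <= smean (signmax (j0, false) (a [::])).
  elim: r => // i r IH; apply: le_trans IH.
  have [ir|ir] := boolP (i \in r).
    rewrite le_eqVlt; apply/orP; left; apply/eqP; congr (smean (signmax _ _)).
    apply/funext => jb; apply/funext => k; rewrite /a inE.
    by case: eqVneq => // ->; rewrite ir.
  apply: (@contraction1 _ _ i) => [jb k ki|jb kb]; rewrite /a inE.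
    by rewrite (negbTE ki).
  by rewrite eqxx/= (negbTE ir).
have sgnl (b : bool) u s : rad (fun i => sgn R b * u i) s = sgn R b * rad u s.
  by rewrite /rad mulr_sumr; apply: eq_bigr => i _; rewrite mulrCA.
exists (signmax (j0, false) (a (index_enum I))).
  move=> j s.
  have aE b : a (index_enum I) (j, b) = fun i => sgn R b * phi (t j i).
    apply/funext => i; rewrite /a mem_index_enum /sgn/=.
    by case: b; rewrite ?expr0 ?expr1 ?mul1r ?mulN1r ?odd.
  have := signmax_ge (j0, false) (j, false) (a (index_enum I)) s.
  have := signmax_ge (j0, false) (j, true) (a (index_enum I)) s.
  rewrite !aE !sgnl /sgn expr0 expr1 mul1r mulN1r => h1 h2.
  by apply/ler_normlP; split.
apply: le_trans (step _) _; apply: le_smean => s.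
have [[j b] ->] := signmax_attained (j0, false) (a [::]) s.
rewrite (_ : a [::] (j, b) = fun i => sgn R b * t j i)// sgnl.
by apply: le_trans (ler_norm _) _; rewrite normrM normr_sign mul1r.
Qed.

End contraction.

Section clip.
Context (R : realType).
Implicit Types c x y : R.

Definition clip c x : R := Num.max (- c) (Num.min c x).

Lemma clip_cases c x : 0 <= c ->
  [\/ x <= - c /\ clip c x = - c, - c <= x <= c /\ clip c x = x | c <= x /\ clip c x = c].
Proof.
move=> c0; rewrite /clip; case: (leP c x) => cx.
  by apply: Or33; split => //; rewrite max_r//; lra.
case: (leP x (- c)) => xc; first exact: Or31.
by apply: Or32; split => //; rewrite !ltW.
Qed.

Lemma clipN c x : 0 <= c -> clip c (- x) = - clip c x.
Proof.
move=> c0.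
by case: (clip_cases x c0) => -[h ->]; case: (clip_cases (- x) c0) => -[h' ->]; lra.
Qed.

Lemma clip_lip c x y : 0 <= c -> `|clip c x - clip c y| <= `|x - y|.
Proof.
move=> c0; have mono u v : u <= v -> `|clip c v - clip c u| <= v - u.
  move=> uv; rewrite ler_norml.
  by case: (clip_cases u c0) => -[h ->]; case: (clip_cases v c0) => -[h' ->];
    apply/andP; split; lra.
have [xy|/ltW xy] := leP x y; last by rewrite (le_trans (mono _ _ xy))// ler_norm.
by rewrite distrC (le_trans (mono _ _ xy))// distrC ler_norm.
Qed.

Lemma clip_le c x : 0 <= c -> `|clip c x| <= c.
Proof.
by move=> c0; rewrite ler_norml; case: (clip_cases x c0) => -[h ->];
  apply/andP; split; lra.
Qed.

Lemma clip_norm_le c x : 0 <= c -> `|clip c x| <= `|x|.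
Proof.
move=> c0; have := clip_lip x 0 c0; rewrite subr0 (_ : clip c 0 = 0) ?subr0//.
by case: (clip_cases 0 c0) => -[h ->]; lra.
Qed.

Lemma clip_sub_le c x : 0 <= c -> c * `|x - clip c x| <= x ^+ 2.
Proof.
move=> c0; case: (clip_cases x c0) => -[h ->].
- by rewrite opprK ler0_norm; nra.
- by rewrite subrr normr0 mulr0 sqr_ge0.
- by rewrite ger0_norm; nra.
Qed.

Lemma clip_sub_sqr_le c x : 0 <= c -> c ^+ 2 * (x - clip c x) ^+ 2 <= x ^+ 4.
Proof.
move=> c0; rewrite -[(x - _) ^+ 2]real_normK ?num_real// -exprMn.
rewrite [x ^+ 4](exprM x 2 2) lerXn2r ?nnegrE ?sqr_ge0 ?mulr_ge0//.
exact: clip_sub_le.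
Qed.

End clip.

(** * Riesz products *)

Section riesz_products.
Context (R : realType) (I : finType).
Implicit Types (a b : I -> R) (s : {ffun I -> bool}).

Definition dot a b : R := \sum_i a i * b i.

Definition sqn a : R := \sum_i a i ^+ 2.

Lemma sqn_ge0 a : 0 <= sqn a.
Proof. by apply: sumr_ge0 => i _; exact: sqr_ge0. Qed.

Lemma dot_le a b : 2 * dot a b <= sqn a + sqn b.
Proof.
rewrite /dot /sqn mulr_sumr -big_split/= ler_sum// => i _.
by have := sqr_ge0 (a i - b i); rewrite sqrrB; lra.
Qed.

Lemma sqnB_le a b : sqn (a \- b) <= 2 * sqn a + 2 * sqn b.
Proof.
rewrite /sqn !mulr_sumr -big_split/= ler_sum// => i _ /=.
by have := sqr_ge0 (a i + b i); rewrite sqrrD sqrrB; lra.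
Qed.

(** The density of a product measure on sign vectors, tilted in the direction a. *)
Definition riesz a s : R := \prod_i (1 + sgn R (s i) * a i).

Lemma riesz_ge0 a s : (forall i, `|a i| <= 1) -> 0 <= riesz a s.
Proof.
move=> a1; apply: prodr_ge0 => i _; have := a1 i; rewrite ler_norml => /andP[? ?].
by rewrite /sgn; case: (s i); rewrite ?expr1 ?expr0; lra.
Qed.

Lemma smean_riesz a : smean (riesz a) = 1.
Proof.
rewrite /riesz (smean_prod (fun i e => 1 + sgn R e * a i)) big1// => i _.
by rewrite /sgn expr1 expr0; field.
Qed.

Lemma smean_riesz2 a b : (forall i, `|a i| <= 1) -> (forall i, `|b i| <= 1) ->
  smean (fun s => riesz a s * riesz b s) <= expR (dot a b).
Proof.
move=> a1 b1; rewrite (_ : (fun s => _) = fun s =>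
    \prod_i ((1 + sgn R (s i) * a i) * (1 + sgn R (s i) * b i))); last first.
  by apply/funext => s; rewrite /riesz -big_split.
rewrite (smean_prod (fun i e => (1 + sgn R e * a i) * (1 + sgn R e * b i))).
rewrite /dot expR_sum; apply: ler_prod => i _.
rewrite (_ : _ / 2 = 1 + a i * b i); last by rewrite /sgn expr1 expr0; field.
rewrite expR_ge1Dx andbT -[leLHS](subrr 1) lerD2l lerNl.
have : `|a i * b i| <= 1 by rewrite normrM mulr_ile1.
by rewrite ler_norml => /andP[]; lra.
Qed.

(** Squaring the bound 1 + z / 2 <= expR (z / 2) is enough to gain a negative
    quadratic term in the exponent. *)
Lemma riesz_factor_le (x : R) : `|x| <= 1 -> 1 + x <= expR (x - x ^+ 2 / 16).
Proof.
rewrite ler_norml => /andP[x1 x2]; set z := x - _.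
have zge : 0 <= 1 + z / 2 by rewrite /z; nra.
have : (1 + z / 2) ^+ 2 <= expR z.
  rewrite [z in expR z](splitr z) expRD -expr2 lerXn2r ?nnegrE ?expR_ge0//.
  exact: expR_ge1Dx.
apply: le_trans; rewrite /z -subr_ge0.
rewrite (_ : _ - _ = x ^+ 2 / 4 * ((1 - x / 16) ^+ 2 - 4^-1)); last by field.
by rewrite mulr_ge0//; nra.
Qed.

Lemma riesz_le a s : (forall i, `|a i| <= 1) ->
  riesz a s <= expR (rad a s - sqn a / 16).
Proof.
move=> a1; rewrite /rad /sqn mulr_suml -sumrB expR_sum; apply: ler_prod => i _.
have s1 : `|sgn R (s i) * a i| <= 1 by rewrite normrM normr_sign mul1r.
have := riesz_factor_le s1; rewrite [(_ * a i) ^+ 2]exprMn sgn_sqr mul1r => ->.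
by move: s1; rewrite ler_norml => /andP[s1 _]; rewrite andbT; lra.
Qed.

End riesz_products.

Section near_orthogonal.
Context (R : realType) (I J : finType).

(** Almost orthogonal vectors d j with small coordinates and norms bounded below
    cannot all have small signed sums. Each Riesz product w j over lam * d j has
    mean 1, and near orthogonality bounds the second moment of their sum W over A
    by A0 * #|A| ^ 2; hence a fixed proportion of the mass of W lies where B <= 4 A0,
    an event of complementary probability at most 1 / (4 A0). On that event,
    however, for all j but one at most, w j is at most expR (8 lam A0 - lam^2 r / 16),
    which is tiny. *)
Lemma near_orthogonal_false (A : {set J}) (d : J -> I -> R)
    (B : {ffun I -> bool} -> R) (lam del r : R) (K : nat) :
  let A0 := expR 1 + 1 in
  0 < lam -> lam ^+ 2 * del <= 1 -> expR (4 * lam ^+ 2) <= K%:R ->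
  8 * lam * A0 - lam ^+ 2 * r / 16 <= - 8 ->
  (forall j i, `|lam * d j i| <= 1) ->
  (forall j s, rad (d j) s <= 2 * B s) -> (forall s, 0 <= B s) -> smean B <= 1 ->
  (forall j, j \in A -> sqn (d j) <= 4) ->
  (forall i, i \in A -> (#|[set j in A | (del < dot (d i) (d j))%R]| * K <= #|A|)%N) ->
  (#|[set j in A | (sqn (d j) < r)%R]| <= 1)%N ->
  (8 <= #|A|)%N -> False.
Proof.
move=> A0 lam0 lamdel expK lamr d1 dB B0 mB d4 orth small A8.
have A00 : 1 < A0 by rewrite ltrDr expR_gt0.
pose m : R := #|A|%:R.
have m8 : 8 <= m by rewrite ler_nat.
have m0 : 0 < m by apply: lt_le_trans m8.
pose w j := riesz (fun i => lam * d j i).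
pose W s := \sum_(j in A) w j s.
have w0 j s : 0 <= w j s by exact: riesz_ge0.
have W0 s : 0 <= W s by apply: sumr_ge0.
have EW : smean W = m.
  by rewrite smean_sum (eq_bigr (fun=> 1)) ?sumr_const// => j _; rewrite smean_riesz.
have EW2 : smean (fun s => W s ^+ 2) <= A0 * m ^+ 2.
  rewrite (_ : (fun s => _) = fun s => \sum_(i in A) \sum_(j in A) w i s * w j s); last first.
    apply/funext => s; rewrite expr2 {1}/W mulr_suml; apply: eq_bigr => i _.
    by rewrite mulr_sumr.
  rewrite smean_sum (@le_trans _ _ (\sum_(i in A) A0 * m))//; last first.
    by rewrite sumr_const -[_ *+ _]mulr_natr -mulrA -expr2.
  apply: ler_sum => i iA; rewrite smean_sum.
  apply: (@le_trans _ _ (\sum_(j in A) (expR 1 +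
      (if del < dot (d i) (d j) then K%:R else 0)))).
    apply: ler_sum => j jA; apply: le_trans (smean_riesz2 (d1 i) (d1 j)) _.
    have -> : dot (fun k => lam * d i k) (fun k => lam * d j k) =
        lam ^+ 2 * dot (d i) (d j).
      by rewrite /dot mulr_sumr; apply: eq_bigr => k _; ring.
    have lam20 : 0 < lam ^+ 2 by rewrite exprn_gt0.
    case: ltP => [_|le].
      apply: le_trans (_ : expR (4 * lam ^+ 2) <= _); last first.
        by rewrite (le_trans expK)// lerDr expR_ge0.
      rewrite ler_expR mulrC ler_pM2r//.
      have := dot_le (d i) (d j); have := d4 i iA; have := d4 j jA; lra.
    by rewrite addr0 ler_expR (le_trans _ lamdel)// ler_pM2l.
  rewrite big_split/= sumr_const -[_ *+ _]mulr_natr -/m mulrDl lerD2l mul1r.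
  rewrite -big_mkcondr/= sumr_const -[_ *+ _]mulr_natl -natrM ler_nat.
  rewrite (leq_trans _ (orth i iA))// leq_mul2r; apply/orP; right.
  by rewrite leq_eqVlt; apply/orP; left; apply/eqP; apply: eq_card => j; rewrite !inE.
pose eta : R := expR (- 8).
have eta8 : eta <= 8^-1.
  rewrite /eta expRN lef_pV2 ?posrE ?expR_gt0//.
  by apply: le_trans (expR_ge1Dx 8); lra.
pose bad s := \sum_(j in A | sqn (d j) < r) w j s.
(* Where B s > 4 A0, Young's inequality bounds W s by the last two terms. *)
have main s : W s <= (m * eta + bad s) + ((4 * A0 * m)^-1 * W s ^+ 2 + (m / 4) * B s).
  have bad0 : 0 <= bad s by apply: sumr_ge0.
  have W2 : 0 <= (4 * A0 * m)^-1 * W s ^+ 2.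
    by rewrite mulr_ge0 ?sqr_ge0// invr_ge0 !mulr_ge0// ltW// (lt_trans _ A00).
  have [Bs|Bs] := leP (B s) (4 * A0).
    rewrite -[leLHS]addr0 lerD//; last by rewrite addr_ge0// mulr_ge0// divr_ge0// ltW.
    rewrite /W /bad (bigID (fun j => sqn (d j) < r))/= addrC lerD2r.
    apply: (@le_trans _ _ (\sum_(j in A | ~~ (sqn (d j) < r)) eta)).
      apply: ler_sum => j /andP[jA]; rewrite -leNgt => rj.
      apply: le_trans (riesz_le _ (d1 j)) _; rewrite ler_expR.
      have -> : rad (fun i => lam * d j i) s = lam * rad (d j) s.
        by rewrite /rad mulr_sumr; apply: eq_bigr => i _; rewrite mulrCA.
      have -> : sqn (fun i => lam * d j i) = lam ^+ 2 * sqn (d j).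
        by rewrite /sqn mulr_sumr; apply: eq_bigr => i _; rewrite exprMn.
      apply: le_trans lamr; apply: lerB.
        rewrite [8 * lam]mulrC -mulrA ler_pM2l// (le_trans (dB j s))//.
        by move: Bs; lra.
      by rewrite ler_pM2r// ler_pM2l// exprn_gt0.
    rewrite sumr_const -[_ *+ _]mulr_natl ler_pM2r ?expR_gt0// ler_nat.
    by apply: subset_leq_card; apply/fintype.subsetP => j; rewrite unfold_in => /andP[].
  have Wle : W s <= (4 * A0 * m)^-1 * (W s ^+ 2 + 4 * A0 ^+ 2 * m ^+ 2).
    rewrite ler_pdivlMl ?mulr_gt0// ?(lt_trans _ A00)//.
    by have := sqr_ge0 (W s - 2 * A0 * m); rewrite sqrrB; lra.
  apply: le_trans Wle _; rewrite mulrDr.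
  have -> : (4 * A0 * m)^-1 * (4 * A0 ^+ 2 * m ^+ 2) = A0 * m.
    by field; rewrite !gt_eqF// (lt_trans _ A00).
  have : m / 4 * (4 * A0) <= m / 4 * B s by rewrite ler_pM2l ?ltW// divr_gt0.
  have : 0 <= m * eta by rewrite mulr_ge0 ?expR_ge0 ?ltW.
  have -> : m / 4 * (4 * A0) = A0 * m by field.
  lra.
have Ebad : smean bad <= 1.
  rewrite smean_sum (eq_bigr (fun=> 1)) => [|j _]; last exact: smean_riesz.
  rewrite sumr_const (_ : #|_| = #|[set j in A | (sqn (d j) < r)%R]|).
    by rewrite lern1.
  by apply: eq_card => j; rewrite !inE.
have := le_smean main; rewrite EW !smeanD smean_cst !smeanZ.
have : (4 * A0 * m)^-1 * smean (fun s => W s ^+ 2) <= m / 4.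
  rewrite ler_pdivrMl ?mulr_gt0// ?(lt_trans _ A00)//.
  by rewrite (le_trans EW2)// le_eqVlt; apply/orP; left; apply/eqP; field.
have : m / 4 * smean B <= m / 4.
  by rewrite ler_piMr// divr_ge0// ltW.
have : m * eta <= m / 8 by rewrite ler_pM2l.
lra.
Qed.

End near_orthogonal.

(** * Sudakov minoration for signed sums *)

Section sudakov.
Context (R : realType).

(** If t i - y has inner product larger than del with a proportion 1 / K of the
    other t j - y, then keep only these j and move y towards t i by the fraction
    del / 4: the energy sqn (t j - y) of all the remaining points drops by del^2 / 4.
    As the energy is nonnegative, after boundedly many steps a set remains that is
    almost orthogonal around its centre. The predicate P is whatever convexity
    preserves along the way. *)
Lemma energy_descent (I J : finType) (t : J -> I -> R) (P : (I -> R) -> Prop)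
    (del : R) (K : nat) :
    0 < del -> del <= 1 -> (0 < K)%N ->
    (forall y j (al : R), P y -> 0 <= al <= 1 -> P (fun i => y i + al * (t j i - y i))) ->
  forall (n : nat) (A : {set J}) (y : I -> R),
    P y -> n%:R * (del ^+ 2 / 4) <= 4 -> (K ^ n * 8 <= #|A|)%N ->
    (forall j, j \in A -> sqn (t j \- y) <= n%:R * (del ^+ 2 / 4)) ->
  exists (A' : {set J}) (y' : I -> R),
    [/\ P y', (8 <= #|A'|)%N, forall j, j \in A' -> sqn (t j \- y') <= 4 &
      forall i, i \in A' ->
        (#|[set j in A' | (del < dot (t i \- y') (t j \- y'))%R]| * K <= #|A'|)%N].
Proof.
move=> del0 del1 K0 Pconv; elim=> [|n IH] A y Py n4 An Ay.
  exists A, y; split=> //.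
    by move=> j jA; rewrite (le_trans (Ay j jA))// mul0r.
  move=> i iA; rewrite (_ : [set j in A | _] = finset.set0) ?cards0//.
  apply/setP => j; rewrite !inE; apply/negbTE/negP => /andP[jA].
  have := dot_le (t i \- y) (t j \- y); have := Ay i iA; have := Ay j jA.
  by rewrite mul0r; lra.
have An8 : (8 <= #|A|)%N by rewrite (leq_trans _ An)// leq_pmull// expn_gt0 K0.
have [/'forall_implyP good|/forallPn[i]] := boolP
    [forall i in A, #|[set j in A | (del < dot (t i \- y) (t j \- y))%R]| * K <= #|A|]%N.
  by exists A, y; split=> // j jA; rewrite (le_trans (Ay j jA)).
rewrite negb_imply -ltnNge => /andP[iA]; set A' := [set j in A | _] => A'K.
have al01 : 0 <= del / 4 <= 1 by apply/andP; split; lra.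
have n1 : n.+1%:R = n%:R + 1 :> R by rewrite -natr1.
apply: (IH A' (fun k => y k + del / 4 * (t i k - y k))).
- exact: Pconv.
- by move: n4; rewrite n1; have := sqr_ge0 del; lra.
- rewrite -(leq_pmul2r K0) (leq_trans _ (ltnW A'K))// (leq_trans _ An)//.
  by rewrite expnSr mulnAC.
- move=> j; rewrite inE => /andP[jA dj].
  have -> : sqn (t j \- (fun k => y k + del / 4 * (t i k - y k))) =
      sqn (t j \- y) - del / 2 * dot (t i \- y) (t j \- y) +
      (del / 4) ^+ 2 * sqn (t i \- y).
    rewrite /sqn /dot !mulr_sumr -sumrB -big_split/=; apply: eq_bigr => k _.
    by field.
  have := Ay j jA; rewrite n1.
  have : (del / 4) ^+ 2 * sqn (t i \- y) <= (del / 4) ^+ 2 * 4.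
    by rewrite ler_wpM2l ?sqr_ge0// (le_trans (Ay i iA)).
  have : del / 2 * del <= del / 2 * dot (t i \- y) (t j \- y).
    by rewrite ler_wpM2l ?divr_ge0// ltW.
  lra.
Qed.

(** A process with signs bounded in mean cannot contain many u-separated vectors
    with small coordinates: [energy_descent] would find among them 8 vectors (with
    their centre y subtracted) that contradict [near_orthogonal_false]. The centre is
    a convex combination of 0 and of the vectors, so it inherits the bounds c and B. *)
Lemma sudakov_minoration (u : R) : 0 < u -> u <= 1 ->
  exists (c : R) (M : nat), 0 < c /\
  forall (I J : finType) (t : J -> I -> R) (B : {ffun I -> bool} -> R),
    (forall j i, `|t j i| <= c) -> (forall j, sqn (t j) <= 3) ->
    (forall j k, j != k -> u ^+ 2 <= sqn (t j \- t k)) ->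
    (forall j s, `|rad (t j) s| <= B s) -> smean B <= 1 ->
  (#|J| <= M)%N.
Proof.
move=> u0 u1; pose A0 : R := expR 1 + 1.
have A00 : 1 < A0 by rewrite ltrDr expR_gt0.
(* The exponent 8 lam A0 - lam^2 (u^2 / 4) / 16 is then equal to - 8 lam. *)
pose lam : R := 64 / u ^+ 2 * (8 * A0 + 8).
have u20 : 0 < u ^+ 2 by rewrite exprn_gt0.
have u21 : u ^+ 2 <= 1 by rewrite expr_le1// ltW.
have lam1 : 1 <= lam.
  have : 1 <= (u ^+ 2)^-1 by rewrite invf_ge1.
  by rewrite /lam; nra.
have lam0 : 0 < lam by rewrite (lt_le_trans _ lam1).
pose del : R := (lam ^+ 2)^-1.
have del0 : 0 < del by rewrite invr_gt0 exprn_gt0.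
have del1 : del <= 1 by rewrite invf_le1 ?exprn_gt0// expr_ge1// ltW.
pose g : R := del ^+ 2 / 4.
have g0 : 0 < g by rewrite divr_gt0 ?exprn_gt0.
have g1 : g <= 1.
  have : del ^+ 2 <= 1 by rewrite expr_le1// ltW.
  by rewrite /g; lra.
(* n energy drops of size g exhaust the initial energy, which is at most 3. *)
pose n := (Num.truncn (3 / g)).+1.
have n3 : 3 <= n%:R * g by rewrite -ler_pdivrMr// ltW// truncnS_gt.
have n4 : n%:R * g <= 4.
  have : (Num.truncn (3 / g))%:R <= 3 / g 
    by have /andP[] := truncn_itv (divr_ge0 (ler0n R 3) (ltW g0)).
  by rewrite ler_pdivlMr// /n -natr1; lra.
pose K := (Num.truncn (expR (4 * lam ^+ 2))).+1.
exists (1 / (2 * lam)), (K ^ n * 8)%N; split; first by rewrite divr_gt0// mulr_gt0.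
move=> I J t B tc t3 sep tB mB; rewrite leqNgt; apply/negP => /ltnW JM.
have [j0 _|J0] := pickP (@predT J); last first.
  by move: JM; rewrite (eq_card0 J0) leqn0 muln_eq0 expn_eq0.
have B0 s : 0 <= B s by exact: le_trans (tB j0 s).
pose P (y : I -> R) := (forall i, `|y i| <= 1 / (2 * lam)) /\ forall s, `|rad y s| <= B s.
have convex_le (x y al b : R) : 0 <= al <= 1 -> `|x| <= b -> `|y| <= b ->
    `|y + al * (x - y)| <= b.
  move=> /andP[al0 al1] xb yb.
  rewrite (_ : y + _ = al * x + (1 - al) * y); last by ring.
  rewrite (le_trans (ler_normD _ _))// !normrM (ger0_norm al0) [`|1 - al|]ger0_norm ?subr_ge0//.
  rewrite (_ : b = al * b + (1 - al) * b); last by ring.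
  by apply: lerD; apply: ler_wpM2l => //; rewrite subr_ge0.
have [] := @energy_descent I J t P del K del0 del1 isT _ n [set: J] (fun=> 0).
- move=> y j al [yc yB] al01; split=> [i|s]; first exact: convex_le.
  have -> : rad (fun i => y i + al * (t j i - y i)) s =
      rad y s + al * (rad (t j) s - rad y s).
    rewrite /rad -sumrB mulr_sumr -big_split/=; apply: eq_bigr => i _; ring.
  exact: convex_le.
- split=> [i|s]; first by rewrite normr0 divr_ge0// mulr_ge0// ltW.
  by rewrite /rad big1 ?normr0// => i _; rewrite mulr0.
- exact: n4.
- by rewrite cardsT.
- move=> j _; rewrite (le_trans _ n3)//.
  apply: le_trans (t3 j); rewrite le_eqVlt; apply/orP; left; apply/eqP.
  by apply: eq_bigr => i _ /=; rewrite subr0.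
move=> A [y [[yc yB] A8 A4 orth]].
apply: (@near_orthogonal_false R I J A (fun j => t j \- y) B lam del (u ^+ 2 / 4) K) => //.
- by rewrite mulfV// gt_eqF// exprn_gt0.
- by rewrite ltW// truncnS_gt.
- rewrite -/A0 (_ : _ - _ = - 8 * lam); first by lra.
  rewrite [X in _ - X](_ : _ = lam * (8 * A0 + 8)); first by ring.
  by rewrite {1 2}/lam; field; rewrite gt_eqF.
- move=> j i; rewrite normrM gtr0_norm//= mulrC -ler_pdivlMr//.
  rewrite (le_trans (ler_normB _ _))// (le_trans (lerD (tc j i) (yc i)))//.
  by rewrite le_eqVlt; apply/orP; left; apply/eqP; field; rewrite gt_eqF.
- move=> j s; have -> : rad (t j \- y) s = rad (t j) s - rad y s.
    by rewrite /rad -sumrB; apply: eq_bigr => i _; rewrite mulrBr.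
  rewrite (le_trans (ler_norm _))// (le_trans (ler_normB _ _))//.
  by have := tB j s; have := yB s; lra.
(* Two vectors within u / 2 of y would be closer to each other than u. *)
- apply/card_le1_eqP => j k; rewrite !inE => /andP[_ ju] /andP[_ ku].
  apply/eqP; apply: contraT => jk; have := sep k j jk.
  have -> : sqn (t k \- t j) = sqn ((t k \- y) \- (t j \- y)).
    by apply: eq_bigr => i _ /=; rewrite opprB addrA subrK.
  have := sqnB_le (t k \- y) (t j \- y); lra.
Qed.

End sudakov.

(** * Pairing with the unit ball of weak L_2 *)

Section weak_l2_block.
Context (R : realType).

Lemma cauchy_schwarz (I : finType) (a b : I -> R) : dot a b ^+ 2 <= sqn a * sqn b.
Proof.
have [b0|b0] := leP (sqn b) 0.
  have bi i : b i = 0.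
    apply/eqP; rewrite -sqrf_eq0 eq_le sqr_ge0 andbT (le_trans _ b0)//.
    by rewrite /sqn (bigD1 i)//= lerDl sumr_ge0// => j _; exact: sqr_ge0.
  by rewrite /dot big1 ?expr0n/= ?mulr_ge0 ?sqn_ge0// => i _; rewrite bi mulr0.
rewrite -subr_ge0 -(pmulr_rge0 _ b0).
suff -> : sqn b * (sqn a * sqn b - dot a b ^+ 2) =
  sqn (fun i => sqn b * a i - dot a b * b i) by exact: sqn_ge0.
have -> : sqn (fun i => sqn b * a i - dot a b * b i) = 
    \sum_i (sqn b ^+ 2 * a i ^+ 2 - 2 * sqn b * dot a b * (a i * b i) +
    dot a b ^+ 2 * b i ^+ 2) by apply: eq_bigr => i _; ring.
rewrite big_split/= sumrB -!mulr_sumr -/(sqn a) -/(sqn b) -/(dot a b).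
by ring.
Qed.

Definition harm (n : nat) : R := \sum_(k < n) k.+1%:R^-1.

(** The weights v whose densities #|T| * v belong to the unit ball of weak L_2 for
    the uniform probability on T. The supremum of the pairings with these weights
    is the Lorentz norm L_(2,1). *)
Definition weak_l2 (T : finType) (v : T -> R) :=
  forall A : {set T}, #|T|%:R * (\sum_(t in A) `|v t|) ^+ 2 <= #|A|%:R.

Context (T : finType).
Implicit Types (v : T -> R).

Lemma weak_l2_0 : weak_l2 (fun _ : T => 0 : R).
Proof. by move=> A; rewrite big1 ?expr0n ?mulr0// => t _; rewrite normr0. Qed.

Lemma weak_l2_sum_le1 v : weak_l2 v -> \sum_t `|v t| <= 1.
Proof.
move=> wv; have [T0|T0] := posnP #|T|.
  by rewrite big_pred0// => t; have := fintype0 t T0.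
have := wv [set: T]%SET; rewrite cardsT -[leRHS]mulr1 ler_pM2l ?ltr0n//.
under eq_bigl do rewrite inE.
by rewrite -[X in _ <= X -> _](expr1n _ 2) ler_pXn2r ?nnegrE ?sumr_ge0.
Qed.

(** The k-th largest value of |v| is at most 1 / sqrt (k #|T|), by the condition on
    the set of the k largest ones; the induction removes the smallest value. *)
Lemma weak_l2_sqn v : weak_l2 v -> #|T|%:R * sqn v <= harm #|T|.
Proof.
move=> wv; suff key n : forall A : {set T}, #|A| = n ->
    #|T|%:R * \sum_(t in A) v t ^+ 2 <= harm n.
  have := key #|T| [set: T]%SET (cardsT _).
  by under eq_bigl do rewrite inE.
elim: n => [|n IH] A An.
  by rewrite (cards0_eq An) big_set0 mulr0 /harm big_ord0.
have [t0 t0A] : exists t, t \in A by apply/card_gt0P; rewrite An.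
case: (arg_minP (fun t => `|v t|) t0A) => t tA' tmin; have tA : t \in A by exact: tA'.
have An' : #|A :\ t| = n by have := cardsD1 t A; rewrite An tA => -[].
rewrite (big_setD1 t)//= mulrDr /harm big_ord_recr/= -/(harm n) addrC.
apply: lerD; last exact: IH.
have h : n.+1%:R * `|v t| <= \sum_(s in A) `|v s|.
  rewrite -An mulr_natl -sumr_const; exact: ler_sum.
have n0 : 0 < n.+1%:R :> R by rewrite ltr0n.
rewrite -(ler_pM2l n0) mulfV ?gt_eqF// -(ler_pM2l n0) mulr1.
apply: le_trans (_ : #|T|%:R * (\sum_(s in A) `|v s|) ^+ 2 <= _);
  last by rewrite (le_trans (wv A))// An.
rewrite -[v t ^+ 2]real_normK ?num_real//.
have -> : n.+1%:R * (n.+1%:R * (#|T|%:R * `|v t| ^+ 2)) =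
  #|T|%:R * (n.+1%:R * `|v t|) ^+ 2 :> R by ring.
by rewrite ler_wpM2l// lerXn2r ?nnegrE ?mulr_ge0 ?sumr_ge0.
Qed.

Context (I : finType).
Implicit Types (y : T -> I -> R) (w : I -> T -> R).

(** By Cauchy-Schwarz and [weak_l2_sqn], the squared norm of L_(2,1) is at most
    harm #|T| times the squared norm of L_2. *)
Lemma sum_pairing_l2_le y w (u : R) : (0 < #|T|)%N -> (forall s, weak_l2 (w s)) ->
    (forall t, sqn (y t) <= u) ->
  \sum_s (\sum_t y t s * w s t) ^+ 2 <= harm #|T| * u.
Proof.
move=> T0 ww yu; have T0R : 0 < #|T|%:R :> R by rewrite ltr0n.
have harm0 : 0 <= harm #|T| by apply: sumr_ge0 => k _; rewrite invr_ge0.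
rewrite -(ler_pM2l T0R) mulr_sumr.
apply: (@le_trans _ _ (\sum_s harm #|T| * \sum_t y t s ^+ 2)).
  apply: ler_sum => s _.
  apply: (@le_trans _ _ (#|T|%:R * (sqn (fun t => y t s) * sqn (w s)))).
    by rewrite ler_pM2l//; exact: (cauchy_schwarz (fun t => y t s)).
  rewrite mulrCA [leRHS]mulrC ler_wpM2l ?sqn_ge0//; exact: weak_l2_sqn.
rewrite -mulr_sumr mulrCA ler_wpM2l// exchange_big/=.
apply: (@le_trans _ _ (\sum_(t : T) u)); first by apply: ler_sum => t _; exact: yu.
by rewrite sumr_const mulr_natl.
Qed.

(** The embedding into L_(2,1) is (2,1)-summing. Linearize the square sum with the
    coefficients b s = sum of y t s * w s t, and bound the weights |b s * w s t| at
    t by the largest one, attained at s = j t. The fibres of j partition T, so by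
    the weak L_2 condition on each fibre the weights of the fibres are square
    summable with sum 1, and Cauchy-Schwarz concludes. *)
Lemma sum_pairing_l1_le y w (L : R) : (forall s, weak_l2 (w s)) ->
    (forall t, \sum_s `|y t s| <= L) ->
  \sum_s (\sum_t y t s * w s t) ^+ 2 <= L ^+ 2.
Proof.
move=> ww yL; have [s0 _|I0] := pickP (@predT I); last first.
  by rewrite big_pred0 ?sqr_ge0// => s; have := I0 s.
have [T0|T0] := posnP #|T|.
  rewrite big1 ?sqr_ge0// => s _; rewrite big_pred0 ?expr0n// => t.
  by have := fintype0 t T0.
have L0 : 0 <= L.
  by have [t0 _|T0'] := pickP (@predT T);
    [rewrite (le_trans _ (yL t0))// sumr_ge0|rewrite (eq_card0 T0') in T0].
pose b s := \sum_t y t s * w s t.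
pose j t := [arg max_(s > s0) `|b s * w s t|]%O.
have jP t s : `|b s * w s t| <= `|b (j t) * w (j t) t|.
  by rewrite /j; case: arg_maxP => // k _; apply.
pose W s := \sum_(t | j t == s) `|w s t|.
have W1 : sqn W <= 1.
  rewrite -(@ler_pM2l _ #|T|%:R) ?ltr0n// mulr1 /sqn mulr_sumr.
  apply: (@le_trans _ _ (\sum_s #|[set t | j t == s]%SET|%:R)).
    apply: ler_sum => s _; have := ww s [set t | j t == s]%SET.
    by under eq_bigl do rewrite inE.
  rewrite -natr_sum ler_nat -[leqRHS]sum1_card (partition_big j predT)//=.
  by apply: leq_sum => s _; rewrite sum1_card cardsE.
have D0 : 0 <= sqn b by exact: sqn_ge0.
have DW : sqn b <= L * dot (fun s => `|b s|) W.
  apply: (@le_trans _ _ (\sum_t L * `|b (j t) * w (j t) t|)).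
    rewrite (_ : sqn b = \sum_s \sum_t y t s * (b s * w s t)); last first.
      apply: eq_bigr => s _; rewrite expr2 {2}/b mulr_sumr.
      by apply: eq_bigr => t _; ring.
    rewrite exchange_big/=; apply: ler_sum => t _.
    apply: (@le_trans _ _ (\sum_s `|y t s| * `|b (j t) * w (j t) t|)).
      apply: ler_sum => s _; rewrite (le_trans (ler_norm _))// normrM.
      by rewrite ler_wpM2l.
    by rewrite -mulr_suml ler_wpM2r.
  rewrite -mulr_sumr ler_wpM2l// (partition_big j predT)//=.
  rewrite /dot ler_sum// => s _; rewrite /W mulr_sumr ler_sum// => t /eqP <-.
  by rewrite normrM.
have bb : sqn (fun s => `|b s|) = sqn b.
  by apply: eq_bigr => s _; rewrite real_normK ?num_real.
have DL : sqn b ^+ 2 <= L ^+ 2 * sqn b.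
  apply: (@le_trans _ _ ((L * dot (fun s => `|b s|) W) ^+ 2)).
    by rewrite lerXn2r ?nnegrE// (le_trans D0).
  rewrite exprMn ler_wpM2l ?sqr_ge0//.
  apply: le_trans (cauchy_schwarz _ _) _; rewrite bb; exact: ler_piMr.
have [b0|b0] := leP (sqn b) 0; first by rewrite (le_trans b0) ?sqr_ge0.
by rewrite -(ler_pM2r b0) -expr2.
Qed.

(** A family that takes its values on a set Q of points costs at most the number
    of points of Q, however large T is. *)
Lemma sum_pairing_range_le y w (p : T -> T) (Q : {set T}) (m : R) :
    (forall s, weak_l2 (w s)) -> (forall t, p t \in Q) ->
    (forall t, sqn (y t) <= m) ->
  \sum_s (\sum_t y (p t) s * w s t) ^+ 2 <= #|Q|%:R * m.
Proof.
move=> ww pQ ym.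
apply: (@le_trans _ _ (\sum_s \sum_(q in Q) y q s ^+ 2)); last first.
  by rewrite exchange_big/= mulr_natl -sumr_const; apply: ler_sum => q _; exact: ym.
apply: ler_sum => s _; set m' := \sum_(q in Q) _.
have m'0 : 0 <= m' by apply: sumr_ge0 => q _; exact: sqr_ge0.
rewrite -[leRHS]sqr_sqrtr// -[leLHS]real_normK ?num_real//.
rewrite lerXn2r ?nnegrE ?sqrtr_ge0// (le_trans (ler_norm_sum _ _ _))//.
apply: (@le_trans _ _ (\sum_t Num.sqrt m' * `|w s t|)).
  apply: ler_sum => t _; rewrite normrM ler_wpM2r// -sqrtr_sqr ler_wsqrtr//.
  by rewrite /m' (big_setD1 (p t))//= lerDl sumr_ge0// => q _; exact: sqr_ge0.
by rewrite -mulr_sumr ler_piMr ?sqrtr_ge0// weak_l2_sum_le1.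
Qed.

End weak_l2_block.

(** * The cotype 2 constant of one block *)

Section block_cotype.
Context (R : realType).

Lemma exists_net (I T : finType) (y : T -> I -> R) (r : R) : 0 <= r ->
  exists Q : {set T},
    (forall a b, a \in Q -> b \in Q -> a != b -> r <= sqn (y a \- y b)) /\
    forall t, exists2 q, q \in Q & sqn (y t \- y q) <= r.
Proof.
move=> r0; pose P (Q : {set T}) :=
  [forall a, forall b, [&& a \in Q, b \in Q & a != b] ==> (r <= sqn (y a \- y b))].
have PP (Q : {set T}) :
    reflect (forall a b, a \in Q -> b \in Q -> a != b -> r <= sqn (y a \- y b)) (P Q).
  apply: (iffP forallP) => [h a b aQ bQ ab|h a].
    by have /forallP/(_ b)/implyP := h a; apply; rewrite aQ bQ.
  by apply/forallP => b; apply/implyP => /and3P[]; exact: h.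
have [Q /maxsetP[/PP sepQ maxQ]] : {Q : {set T} | maxset P Q}.
  by apply: ex_maxset; exists finset.set0; apply/PP => a b; rewrite inE.
exists Q; split=> // t; have [tQ|tQ] := boolP (t \in Q).
  by exists t => //; rewrite /sqn big1// => i _ /=; rewrite subrr expr0n.
have sqnC a b : sqn (y a \- y b) = sqn (y b \- y a).
  by apply: eq_bigr => i _ /=; rewrite -sqrrN opprB.
have [/existsP[q /andP[qQ qr]]|/existsPn nq] :=
  boolP [exists q, (q \in Q) && (sqn (y t \- y q) <= r)]; first by exists q.
have far q : q \in Q -> r <= sqn (y t \- y q).
  by move=> qQ; have := nq q; rewrite qQ/= -ltNge => /ltW.
have /maxQ eqQ : P (t |: Q).
  apply/PP => a b; rewrite !inE => /orP[/eqP ->|aQ] /orP[/eqP ->|bQ] ab.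
  - by rewrite eqxx in ab.
  - exact: far.
  - by rewrite sqnC; exact: far.
  - exact: sepQ.
by move: tQ; rewrite -eqQ ?finset.subsetUr// setU11.
Qed.

(** Clip the coordinates of x t at c to get y t, and let p t be the nearest point of
    a maximal u-separated set of indices. Then x t = y (p t) + (y t - y (p t)) +
    (x t - y t), where the first term takes boundedly many values by
    [sudakov_minoration], the second is u-small in l_2, and the third is bounded
    by 3 / c in l_1. *)
Lemma block_cotype_normalized (u : R) : 0 < u -> u <= 1 ->
  exists2 F : R, 1 <= F &
  forall (I T : finType) (x : T -> I -> R) (w : I -> T -> R) (B : {ffun I -> bool} -> R),
    (0 < #|T|)%N -> (forall s, weak_l2 (w s)) ->
    (forall t s, `|rad (x t) s| <= B s) -> smean B <= 1 ->
  \sum_s (\sum_t x t s * w s t) ^+ 2 <= 3 * (u ^+ 2 * harm R #|T| + F).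
Proof.
move=> u0 u1; have [c [M [c0 sud]]] := sudakov_minoration u0 u1.
exists (M%:R * 3 + (3 / c) ^+ 2 + 1); first by rewrite lerDr addr_ge0 ?sqr_ge0 ?mulr_ge0.
move=> I T x w B T0 ww xB mB.
have x3 t : sqn (x t) <= 3.
  rewrite -[3]mulr1 -[X in 3 * X](expr1n R 2); apply: khintchine.
  by rewrite (le_trans _ mB)// le_smean.
have [B' yB' mB'] := contraction_principle (fun a b => clip_lip a b (ltW c0))
  (fun a => clipN a (ltW c0)) xB.
pose y t i := clip c (x t i).
have y3 t : sqn (y t) <= 3.
  apply: le_trans (x3 t); apply: ler_sum => i _.
  rewrite -[y t i ^+ 2]real_normK ?num_real// -[leRHS]real_normK ?num_real//.
  by rewrite lerXn2r ?nnegrE// clip_norm_le// ltW.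
have [Q [sepQ netQ]] := exists_net y (ltW (exprn_gt0 2 u0)).
have QM : (#|Q| <= M)%N.
  rewrite -(card_sig (mem Q)); apply: (sud I _ (fun q => y (val q)) B') => //.
  - by move=> q i; exact/clip_le/ltW.
  - move=> a b ab; apply: sepQ; [exact: valP a|exact: valP b|].
    by apply: contraNneq ab => /val_inj ->.
  - by move=> q s; exact: yB'.
  - exact: le_trans mB' mB.
have [p pQ] := choice (fun t => let: ex_intro2 q qQ qr := netQ t in
  ex_intro (fun q => q \in Q /\ sqn (y t \- y q) <= u ^+ 2) q (conj qQ qr)).
have h1 := sum_pairing_range_le ww (fun t => (pQ t).1) y3.
have h2 := @sum_pairing_l2_le R T I (fun t => y t \- y (p t)) w (u ^+ 2) T0 ww
  (fun t => (pQ t).2).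
have h3 : \sum_s (\sum_t (x t s - y t s) * w s t) ^+ 2 <= (3 / c) ^+ 2.
  apply: (@sum_pairing_l1_le R T I (fun t s => x t s - y t s)) => // t.
  rewrite ler_pdivlMr// (le_trans _ (x3 t))// mulr_suml ler_sum// => i _.
  by rewrite mulrC; exact/clip_sub_le/ltW.
have h4 : #|Q|%:R * 3 <= M%:R * 3 :> R by rewrite ler_pM2r// ler_nat.
apply: (@le_trans _ _ (\sum_s 3 * ((\sum_t y (p t) s * w s t) ^+ 2 +
   (\sum_t (y t \- y (p t)) s * w s t) ^+ 2 + (\sum_t (x t s - y t s) * w s t) ^+ 2))).
  apply: ler_sum => s _.
  rewrite (_ : \sum_t x t s * w s t = \sum_t y (p t) s * w s t +
      \sum_t (y t \- y (p t)) s * w s t + \sum_t (x t s - y t s) * w s t); last first.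
    by rewrite -!big_split/=; apply: eq_bigr => t _; ring.
  set a := \sum_t _; set b := \sum_t _; set e := \sum_t _.
  have := sqr_ge0 (a - b); have := sqr_ge0 (b - e); have := sqr_ge0 (a - e); lra.
rewrite -mulr_sumr !big_split/=; lra.
Qed.

Lemma block_cotype (u : R) : 0 < u -> u <= 1 ->
  exists2 F : R, 1 <= F &
  forall (I T : finType) (x : T -> I -> R) (w : I -> T -> R) (B : {ffun I -> bool} -> R),
    (0 < #|T|)%N -> (forall s, weak_l2 (w s)) -> (forall t s, `|rad (x t) s| <= B s) ->
  \sum_s (\sum_t x t s * w s t) ^+ 2 <= 3 * (u ^+ 2 * harm R #|T| + F) * smean B ^+ 2.
Proof.
move=> u0 u1; have [F F1 blk] := block_cotype_normalized u0 u1.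
exists F => // I T x w B T0 ww xB.
have [t0 _|T0'] := pickP (@predT T); last by rewrite (eq_card0 T0') in T0.
have B0 s : 0 <= B s by exact: le_trans (xB t0 s).
have := smean_ge0 B0; rewrite le_eqVlt => /orP[/eqP mB0|mB].
  have x0 t i : x t i = 0.
    have : sqn (x t) <= 0.
      rewrite -[leRHS](mulr0 3) -[X in 3 * X](expr0n R 2).
      by apply: khintchine; rewrite mB0 le_smean.
    move=> xt; apply/eqP; rewrite -sqrf_eq0 eq_le sqr_ge0 andbT (le_trans _ xt)//.
    by rewrite /sqn (bigD1 i)//= lerDl sumr_ge0// => j _; exact: sqr_ge0.
  rewrite -mB0 expr0n/= mulr0 big1// => s _; rewrite big1 ?expr0n// => t _.
  by rewrite x0 mul0r.
have radZ (a : R) f s : rad (fun i => a * f i) s = a * @rad R I f s.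
  by rewrite /rad mulr_sumr; apply: eq_bigr => i _; rewrite mulrCA.
have := @blk I T (fun t i => (smean B)^-1 * x t i) w (fun s => (smean B)^-1 * B s) T0 ww.
rewrite smeanZ mulVf ?gt_eqF// lexx => /(_ _ isT) h.
rewrite -ler_pdivrMr ?exprn_gt0// mulrC mulr_sumr.
apply: le_trans (h _) => [|t s]; last first.
  by rewrite radZ normrM gtr0_norm ?invr_gt0// ler_pM2l ?invr_gt0.
rewrite ler_sum// => s _; rewrite -exprVn -exprMn mulr_sumr.
by under eq_bigr do rewrite mulrA.
Qed.

End block_cotype.

(** * The little Grothendieck theorem *)

Section little_grothendieck.
Context (R : realType) (H : completeNormedModType R) (T : finType) (e : T -> H).

Lemma hilbert_parallelogram : is_hilbert H -> forall u v : H,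
  `|u + v| ^+ 2 + `|u - v| ^+ 2 = 2 * `|u| ^+ 2 + 2 * `|v| ^+ 2.
Proof.
case=> dt dtE u v; rewrite !dtE !linearDl/= !linearDr/= linearNr linearNl/= linearNr.
by rewrite linearNl/=; ring.
Qed.

Let two_summing (k : R) := forall (I : finType) (x : T -> I -> R) (r : R), 0 < r ->
  (forall t, sqn (x t) <= r) -> \sum_s `|\sum_t x t s *: e t| ^+ 2 <= k * r.

Let two_summing_exists : two_summing (#|T|%:R * \sum_t `|e t| ^+ 2).
Proof.
move=> I x r r0 xr.
apply: (@le_trans _ _ (\sum_s \sum_t x t s ^+ 2 * \sum_t `|e t| ^+ 2)).
  apply: ler_sum => s _; rewrite -mulr_suml.
  apply: (@le_trans _ _ ((dot (fun t => `|x t s|) (fun t => `|e t|)) ^+ 2)).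
    rewrite lerXn2r ?nnegrE//; first by apply: sumr_ge0 => t _; exact: mulr_ge0.
    rewrite (le_trans (ler_norm_sum _ _ _))// ler_sum// => t _.
    by rewrite normrZ.
  apply: le_trans (cauchy_schwarz _ _) _.
  rewrite le_eqVlt; apply/orP; left; apply/eqP; congr (_ * _).
  by apply: eq_bigr => t _; rewrite real_normK ?num_real.
rewrite exchange_big/=; under eq_bigr do rewrite -mulr_suml.
rewrite -mulr_suml mulrAC ler_wpM2r//; first by apply: sumr_ge0 => t _; exact: sqr_ge0.
apply: (@le_trans _ _ (\sum_(t : T) r)); first by apply: ler_sum => t _; exact: xr.
by rewrite sumr_const mulr_natl.
Qed.

Context (a : R).
Hypothesis eH : is_hilbert H.
Hypothesis a0 : 0 <= a.
Hypothesis ea : forall (c : T -> R) (m : R), 0 <= m -> (forall t, `|c t| <= m) ->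
  `|\sum_t c t *: e t| <= a * m.

(** Replace the family x by its signed sums X. At each point the fourth moment of
    X is bounded, so truncation at height m = sqrt (12 r) leaves a remainder whose
    square function is at most r / 4: the truncated part is estimated by the norm a
    of the operator and the remainder by the constant k itself. *)
Let two_summing_improve k : 0 <= k -> two_summing k -> two_summing (24 * a ^+ 2 + k / 2).
Proof.
move=> k0 sk I x r r0 xr.
pose m := Num.sqrt (12 * r).
have m0 : 0 < m by rewrite sqrtr_gt0 mulr_gt0.
have m2 : m ^+ 2 = 12 * r by rewrite sqr_sqrtr// mulr_ge0 ?ltW.
pose X (s : {ffun I -> bool}) t := rad (x t) s.
have XE : \sum_s `|\sum_t x t s *: e t| ^+ 2 =
    smean (fun s => `|\sum_t X s t *: e t| ^+ 2).
  rewrite -(@smean_parallelogram R I H (fun v => `|v| ^+ 2)); last 2 first.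
  - by rewrite normr0 expr0n.
  - exact: hilbert_parallelogram.
  congr smean; apply/funext => s; congr (`|_| ^+ 2).
  under eq_bigr do rewrite scaler_sumr.
  rewrite exchange_big/=; apply: eq_bigr => t _; rewrite scaler_suml.
  by apply: eq_bigr => i _; rewrite scalerA.
have two0 : 0 < 2 ^+ #|I| :> R by rewrite exprn_gt0.
have rest : smean (fun s => `|\sum_t (X s t - clip m (X s t)) *: e t| ^+ 2) <= k * (r / 4).
  rewrite /smean ler_pdivrMr// -mulrA [_ / 4 * _]mulrC.
  apply: (sk _ (fun t s => X s t - clip m (X s t))) => [|t].
    by rewrite mulr_gt0// divr_gt0.
  rewrite -(@ler_pM2l _ (m ^+ 2)) ?exprn_gt0// /sqn mulr_sumr.
  apply: (@le_trans _ _ (\sum_s X s t ^+ 4)).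
    by apply: ler_sum => s _; exact/clip_sub_sqr_le/ltW.
  have : smean (fun s => X s t ^+ 4) <= 3 * r ^+ 2.
    apply: le_trans (smean_rad4 (x t)) _; rewrite ler_pM2l//.
    rewrite lerXn2r ?nnegrE ?sqn_ge0 ?(ltW r0)//; exact: xr.
  rewrite /smean ler_pdivrMr// => /le_trans; apply.
  by rewrite m2 le_eqVlt; apply/orP; left; apply/eqP; field.
have main s : `|\sum_t X s t *: e t| ^+ 2 <=
    24 * a ^+ 2 * r + 2 * `|\sum_t (X s t - clip m (X s t)) *: e t| ^+ 2.
  have h : `|\sum_t clip m (X s t) *: e t| <= a * m.
    by apply: ea => [|t]; [exact: ltW|exact/clip_le/ltW].
  have -> : \sum_t X s t *: e t = \sum_t clip m (X s t) *: e t +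
      \sum_t (X s t - clip m (X s t)) *: e t.
    by rewrite -big_split/=; apply: eq_bigr => t _; rewrite -scalerDl addrC subrK.
  set U := \sum_t clip _ _ *: _ in h *; set V := \sum_t _.
  have h2 : `|U| ^+ 2 <= a ^+ 2 * (12 * r).
    by rewrite -m2 -exprMn lerXn2r ?nnegrE ?mulr_ge0// ltW.
  have : `|U + V| ^+ 2 <= (`|U| + `|V|) ^+ 2.
    by rewrite lerXn2r ?nnegrE ?addr_ge0// ler_normD.
  by have := sqr_ge0 (`|U| - `|V|); lra.
rewrite XE; apply: le_trans (le_smean main) _.
by rewrite smeanD smean_cst smeanZ; lra.
Qed.

(** Iterating the improvement k |-> 24 a^2 + k / 2 from any finite constant comes
    arbitrarily close to its fixed point 48 a^2. *)
Lemma little_grothendieck (I : finType) (x : T -> I -> R) (r : R) : 0 < r ->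
    (forall t, sqn (x t) <= r) ->
  \sum_s `|\sum_t x t s *: e t| ^+ 2 <= (48 * a ^+ 2 + 1) * r.
Proof.
move=> r0 xr; set k0 : R := #|T|%:R * \sum_t `|e t| ^+ 2.
have k00 : 0 <= k0 by rewrite mulr_ge0// sumr_ge0// => t _; exact: sqr_ge0.
have iter n : two_summing (48 * a ^+ 2 + k0 / 2 ^+ n).
  elim: n => [|n IH].
    move=> J y q q0 yq; apply: le_trans (two_summing_exists q0 yq) _.
    by rewrite ler_pM2r// expr0 divr1 lerDr mulr_ge0 ?sqr_ge0.
  rewrite (_ : _ + _ = 24 * a ^+ 2 + (48 * a ^+ 2 + k0 / 2 ^+ n) / 2); last first.
    by rewrite [2 ^+ n.+1]exprS; field; rewrite expf_neq0.
  apply: two_summing_improve => //.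
  apply: addr_ge0; first by rewrite mulr_ge0 ?sqr_ge0.
  by apply: divr_ge0 => //; exact: exprn_ge0.
apply: le_trans (iter (Num.truncn k0).+1 I x r r0 xr) _.
rewrite ler_pM2r// lerD2l ler_pdivrMr ?exprn_gt0// mul1r.
rewrite (le_trans (ltW (truncnS_gt k0)))// -natrX ler_nat ltnW//.
exact: ltn_expl.
Qed.

End little_grothendieck.

(** * Translates of the extremal function of a block *)

Section harmonic_test.
Context (R : realType) (n : nat).

Lemma harm_ge1 : 1 <= harm R n.+1.
Proof.
rewrite /harm big_ord_recl/= invr1 lerDl.
by apply: sumr_ge0 => i _; rewrite invr_ge0.
Qed.

Definition invsqrt (i : nat) : R := (Num.sqrt i.+1%:R)^-1.

Lemma invsqrt_ge0 i : 0 <= invsqrt i.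
Proof. by rewrite invr_ge0 sqrtr_ge0. Qed.

Lemma sqr_invsqrt i : invsqrt i ^+ 2 = i.+1%:R^-1.
Proof. by rewrite /invsqrt exprVn sqr_sqrtr. Qed.

(** The bound 2 sqrt #|A| of the sum over the #|A| first indices; the induction
    removes the largest index, which is at least #|A| - 1. *)
Lemma sum_invsqrt_le (A : {set 'I_n.+1}) :
  \sum_(i in A) invsqrt i <= 2 * Num.sqrt #|A|%:R.
Proof.
have [k] := ubnP #|A|; elim: k A => // k IH A Ak.
have [->|[t0 t0A]] := set_0Vmem A; first by rewrite big_set0 mulr_ge0 ?sqrtr_ge0.
case: (@arg_maxnP _ t0 (mem A) val t0A) => i iA' imax; have iA : i \in A by exact: iA'.
have Ai : #|A| = #|A :\ i|.+1 by rewrite (cardsD1 i) iA.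
have Ai1 : (#|A| <= i.+1)%N.
  have : A \subset [set widen_ord (ltn_ord i) j | j : 'I_i.+1]%SET.
    apply/fintype.subsetP => j jA; apply/imsetP.
    by exists (Ordinal (imax j jA : (j < i.+1)%N)) => //; apply: val_inj.
  move/subset_leq_card/leq_trans; apply.
  by rewrite (leq_trans (leq_imset_card _ _))// card_ord.
rewrite (big_setD1 i)//= addrC.
apply: le_trans (_ : 2 * Num.sqrt #|A :\ i|%:R + (Num.sqrt #|A|%:R)^-1 <= _).
  apply: lerD; first by apply: IH; move: Ak; rewrite Ai ltnS.
  have A0 : (0 < #|A|)%N by rewrite Ai.
  by rewrite lef_pV2 ?posrE ?sqrtr_gt0 ?ltr0n// ler_wsqrtr// ler_nat.
have p2 : Num.sqrt #|A|%:R ^+ 2 = Num.sqrt #|A :\ i|%:R ^+ 2 + 1 :> R.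
  by rewrite !sqr_sqrtr// Ai -natr1.
have p0 : 0 < Num.sqrt #|A|%:R :> R by rewrite sqrtr_gt0 Ai.
move: p2 p0; set p := Num.sqrt _; set q := Num.sqrt _ => p2 p0.
rewrite addrC -lerBrDr -mulrBr -[leLHS]mul1r ler_pdivrMr//.
by have := sqr_ge0 (p - q); lra.
Qed.

(** The translates by s of the function 1 / sqrt (i + 1) on the cyclic group of order
    n + 1: the sum of their squares over s is the same at all points. *)
Definition rot_test (t s : 'I_n.+1) : R := invsqrt ((t + s)%R : 'I_n.+1).

Definition rot_weight (s t : 'I_n.+1) : R :=
  (2 * Num.sqrt n.+1%:R)^-1 * rot_test t s.

Lemma sqn_rot_test t : sqn (rot_test t) = harm R n.+1.
Proof.
rewrite /sqn /harm [RHS](reindex_inj (addrI t)).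
by apply: eq_bigr => s _; rewrite /rot_test sqr_invsqrt.
Qed.

Lemma weak_l2_rot_weight s : weak_l2 (rot_weight s).
Proof.
move=> A; rewrite card_ord.
have sN : 0 < Num.sqrt n.+1%:R :> R by rewrite sqrtr_gt0.
have -> : \sum_(t in A) `|rot_weight s t| =
    (2 * Num.sqrt n.+1%:R)^-1 * \sum_(i in [set t + s | t in A]%SET) invsqrt i.
  rewrite big_imset/=; last by move=> t t' _ _; exact: addIr.
  rewrite mulr_sumr; apply: eq_bigr => t _.
  by rewrite ger0_norm// mulr_ge0 ?invsqrt_ge0// invr_ge0 mulr_ge0// ltW.
have := sum_invsqrt_le [set t + s | t in A]%SET.
rewrite card_imset; last exact: addIr.
set S := \sum_(i in _) _ => hS.
have S0 : 0 <= S by apply: sumr_ge0 => i _; exact: invsqrt_ge0.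
have S2 : S ^+ 2 <= (2 * Num.sqrt #|A|%:R) ^+ 2.
  by rewrite lerXn2r ?nnegrE ?mulr_ge0 ?sqrtr_ge0.
move: S2; rewrite !exprMn exprVn exprMn !sqr_sqrtr// => S2.
have -> : n.+1%:R * ((2 ^+ 2 * n.+1%:R)^-1 * S ^+ 2) = S ^+ 2 / 4 :> R.
  by have := pnatr_eq0 R n.+1; set N := n.+1%:R => /negbT N0; field.
by rewrite ler_pdivrMr//; move: S2; lra.
Qed.

Lemma rot_pairing s :
  \sum_t rot_test t s * rot_weight s t = harm R n.+1 / (2 * Num.sqrt n.+1%:R).
Proof.
rewrite mulrC /harm [in RHS](reindex_inj (addIr s)) mulr_sumr.
by apply: eq_bigr => t _; rewrite /rot_weight mulrCA -expr2 sqr_invsqrt.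
Qed.

End harmonic_test.

(** * The Banach space of bounded functions on a set *)

Section bounded_functions.
Context (R : realType) (J : Type).

Definition linf_pred : {pred J -> R} :=
  mem [set f : J -> R | exists M, forall j, `|f j| <= M].

Record linf : Type := Linf { linf_fun :> J -> R ; linf_mem : linf_fun \in linf_pred }.

HB.instance Definition _ := [isSub for linf_fun].
HB.instance Definition _ := [Choice of linf by <:].

Lemma linf_submod_closed : submod_closed linf_pred.
Proof.
split; first by rewrite inE /=; exists 0 => j; rewrite normr0.
move=> a f g; rewrite !inE /= => -[M fM] [L gL]; exists (`|a| * M + L) => j.
rewrite (le_trans (ler_normD _ _))// lerD//.
by rewrite [(a *: f) j]/(a * f j) normrM ler_wpM2l.
Qed.

HB.instance Definition _ := GRing.isSubmodClosed.Build R (J -> R) linf_pred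
  linf_submod_closed.
HB.instance Definition _ := [SubChoice_isSubLmodule of linf by <:].

Implicit Types f g : linf.

Definition linf_norm f : R := sup (range (fun j => `|f j|)).

Lemma linf_norm_ub f j : `|f j| <= linf_norm f.
Proof.
apply: ub_le_sup; last by exists j.
by have := linf_mem f; rewrite inE => -[M fM]; exists M => _ [k _ <-].
Qed.

Lemma linf_norm_le f (e : R) : 0 <= e -> (forall j, `|f j| <= e) -> linf_norm f <= e.
Proof.
move=> e0 fe; have [[j _]|J0] := pselect ([set: J] !=set0).
  by apply: ge_sup => [|_ [k _ <-]//]; exists `|f j|; exists j.
rewrite /linf_norm (_ : [set `|f j| | j in _] = set0) ?sup0//.
by rewrite -subset0 => y [j _ _]; apply: J0; exists j.
Qed.

Lemma linf_norm_ge0 f : 0 <= linf_norm f.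
Proof.
have [[j _]|J0] := pselect ([set: J] !=set0).
  exact: le_trans (normr_ge0 (f j)) (linf_norm_ub f j).
rewrite /linf_norm (_ : [set `|f j| | j in _] = set0) ?sup0//.
by rewrite -subset0 => y [j _ _]; apply: J0; exists j.
Qed.

Lemma linf_normD f g : linf_norm (f + g) <= linf_norm f + linf_norm g.
Proof.
apply: linf_norm_le => [|j]; first by rewrite addr_ge0 ?linf_norm_ge0.
by rewrite (le_trans (ler_normD _ _)) ?lerD ?linf_norm_ub.
Qed.

Lemma linf_normZ (a : R) f : linf_norm (a *: f) = `|a| * linf_norm f.
Proof.
have le b g : linf_norm (b *: g) <= `|b| * linf_norm g.
  apply: linf_norm_le => [|j]; first by rewrite mulr_ge0 ?linf_norm_ge0.
  by rewrite [(b *: g) j]/(b * g j) normrM ler_wpM2l ?linf_norm_ub.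
apply/eqP; rewrite eq_le le/=.
have [->|a0] := eqVneq a 0; first by rewrite normr0 mul0r linf_norm_ge0.
by rewrite -ler_pdivlMl ?normr_gt0// -normfV -[in leLHS](scalerK a0 f) le.
Qed.

Lemma linf_norm0_eq0 f : linf_norm f = 0 -> f = 0.
Proof.
move=> f0; apply: val_inj; apply/funext => j.
by apply/eqP; rewrite -normr_le0 -f0 linf_norm_ub.
Qed.

HB.instance Definition _ := Lmodule_isNormed.Build R linf
  linf_normD linf_normZ linf_norm0_eq0.

Lemma linf_complete (F : set_system linf) : ProperFilter F -> cauchy F -> cvg F.
Proof.
move=> FF Fc.
have close (e : R) : 0 < e ->
    \forall f \near F, \forall g \near F, forall j, `|(f : linf) j - (g : linf) j| <= e.
  move=> e0; apply: nearP_dep; have /cauchy_ballP/(_ e e0) := Fc.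
  apply: filterS => -[f g] /=; rewrite -ball_normE/= => /ltW fg j.
  by apply: le_trans fg; exact: (linf_norm_ub (f - g) j).
have cvj j : cvg ((fun f : linf => f j) @ F).
  apply: cauchy_cvg; apply: cauchy_exP => e e0.
  have [f fF] := filter_ex (close _ (divr_gt0 e0 (ltr0n R 2))).
  exists (f j); apply: filterS fF => g fg.
  rewrite -ball_normE/=; apply: le_lt_trans (fg j) _.
  by rewrite ltr_pdivrMr// ltr_pMr// ltr1n.
pose l j : R := lim ((fun f : linf => f j) @ F).
have Fl (e : R) : 0 < e -> \forall f \near F, forall j, `|(f : linf) j - l j| <= e.
  move=> e0; have := close _ e0; apply: filterS => f fF j.
  have cfl : (fun g : linf => `|f j - g j|) @ F --> `|f j - l j|.
    by apply: cvg_norm; apply: cvgB; [exact: cvg_cst|exact: cvj].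
  apply: (closed_cvg (fun y : R => y <= e)) cfl; first exact: closed_le.
  by apply: filterS fF => g; exact.
have lb : l \in linf_pred.
  have [f fl] := filter_ex (Fl _ ltr01).
  rewrite inE; exists (linf_norm f + 1) => j.
  rewrite -[l j](subKr (f j)) (le_trans (ler_normB _ _))// lerD ?linf_norm_ub//.
apply/cvg_ex; exists (Linf lb); apply/cvgrPdist_le => e e0.
have := Fl _ e0; apply: filterS => f fl.
apply: linf_norm_le => [|j]; first exact: ltW.
by rewrite -[(_ - f) j]/(l j - f j) distrC.
Qed.

HB.instance Definition _ := Uniform_isComplete.Build linf linf_complete.

Lemma linf_norm_half (j0 : J) (f : linf) : exists j, `|f| <= 2 * `|f j|.
Proof.
apply: contrapT => nj.
have fj j : `|f j| < linf_norm f / 2.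
  rewrite ltNge; apply/negP => fj; apply: nj; exists j.
  by rewrite mulrC -ler_pdivrMr.
have := linf_norm_ge0 f; have := normr_ge0 (f j0); have := fj j0.
have : linf_norm f <= linf_norm f / 2.
  by apply: linf_norm_le => [|j]; [rewrite divr_ge0 ?linf_norm_ge0|exact: ltW].
lra.
Qed.

End bounded_functions.

(** * Expectations along a Rademacher sequence *)

Section rademacher_expectation.
Context (R : realType) (d : measure_display) (Omega : measurableType d)
        (P : probability Omega R).
Import HBNNSimple.
Import finmap.

Lemma nnsfun_of_sum (K : Type) (r : seq K) (f : K -> R) (A : K -> set Omega) :
    (forall k, 0 <= f k) -> (forall k, measurable (A k)) ->
  exists2 h : {nnsfun Omega >-> R},
    (forall w, h w = \sum_(k <- r) f k * \1_(A k) w) &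
    sintegral P h = (\sum_(k <- r) (f k)%:E * P (A k))%E.
Proof.
move=> f0 mA; elim: r => [|k r [h hE hI]].
  exists nnsfun0 => [w|]; first by rewrite big_nil.
  by rewrite big_nil sintegral0.
exists (add_nnsfun (scale_nnsfun (indic_nnsfun R (mA k)) (f0 k)) h) => [w|].
  by rewrite big_cons -hE.
rewrite big_cons -hI -(sintegral_indic P (A k)).
rewrite -(@sintegralrM _ _ _ P (f k) (indic_nnsfun R (mA k))).
by rewrite -(@sintegralD _ _ _ P (scale_nnsfun (indic_nnsfun R (mA k)) (f0 k)) h).
Qed.

Definition sign_event (eps : nat -> {RV P >-> R}) (S : nat) (s : {ffun 'I_S -> bool}) :
    set Omega :=
  [set w | forall i : 'I_S, eps i w = sgn R (s i)].

Lemma sign_eventE (eps : nat -> {RV P >-> R}) (S : nat) (s : {ffun 'I_S -> bool}) :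
  sign_event eps s = \bigcap_(i in [set` finmap.seq_fset imfset_key (iota 0 S)])
    (eps i @^-1` [set sgn R (oapp s false (insub i))]).
Proof.
apply/seteqP; split=> w sw i /=.
  rewrite finmap.seq_fsetE mem_iota add0n => /= iS.
  by rewrite insubT/=; exact: (sw (Ordinal iS)).
have /sw/= -> : [set` finmap.seq_fset imfset_key (iota 0 S)] (i : nat).
  by rewrite /= finmap.seq_fsetE mem_iota add0n/=.
by rewrite valK.
Qed.

Lemma measurable_sign_event (eps : nat -> {RV P >-> R}) (S : nat) (s : {ffun 'I_S -> bool}) :
  measurable (sign_event eps s).
Proof.
have -> : sign_event eps s = \bigcap_(i in [set: 'I_S]) (eps i @^-1` [set sgn R (s i)]).
  by apply/seteqP; split=> w sw i //=; exact: sw.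
exact: fin_bigcap_measurable.
Qed.

Lemma prob_sign_event (eps : nat -> {RV P >-> R}) (S : nat) (s : {ffun 'I_S -> bool}) :
  rademacher_sequence eps -> P (sign_event eps s) = ((2 ^+ S)^-1)%:E.
Proof.
move=> [ind rad_eps]; rewrite sign_eventE.
rewrite (ind _ (fun i => [set sgn R (oapp s false (insub i))]))//.
have half i b : P (eps i @^-1` [set sgn R b]) = (2^-1)%:E.
  have [h1 h2] := rad_eps i.
  by rewrite /sgn; case: b; rewrite -[2^-1]mul1r ?expr1 ?expr0.
under eq_bigr do rewrite half.
rewrite prodEFin; congr EFin.
rewrite big_const_seq count_predT finmap.size_seq_fset undup_id ?iota_uniq// size_iota.
by rewrite iter_mulr_1 exprVn.
Qed.

(** The sign patterns of the first S variables partition the probability space, up to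
    a null set, into events of probability 2 ^ - S. The integral of g dominates that
    of the simple function equal to f s on the event of s. *)
Lemma smean_le_expectation (eps : nat -> {RV P >-> R}) (S : nat)
    (f : {ffun 'I_S -> bool} -> R) (g : Omega -> R) :
    rademacher_sequence eps -> (forall s, 0 <= f s) -> (forall w, 0 <= g w) ->
    (forall w s, sign_event eps s w -> f s <= g w) ->
  ((smean f)%:E <= 'E_P[g])%E.
Proof.
move=> rad_eps f0 g0 fg; rewrite unlock ge0_integralTE; last by move=> w; rewrite lee_fin.
have [h hE hI] := nnsfun_of_sum (index_enum {ffun 'I_S -> bool}) f0
  (@measurable_sign_event eps S).
have -> : (smean f)%:E = sintegral P h.
  rewrite hI; under eq_bigr do rewrite prob_sign_event// -EFinM.
  by rewrite sumEFin /smean card_ord mulr_suml.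
apply: ereal_sup_ubound; exists h => // w.
rewrite lee_fin hE.
have [[s sw]|nw] := pselect (exists s : {ffun 'I_S -> bool}, sign_event eps s w).
  rewrite (bigD1 s)//= big1 ?addr0 => [|s' s's].
    by rewrite indicE mem_set// mulr1 fg.
  rewrite indicE memNset ?mulr0// => s'w; case/eqP: s's.
  apply/ffunP => i; have := sw i; rewrite (s'w i) /sgn.
  by case: (s i); case: (s' i) => //; rewrite expr0 expr1; lra.
by rewrite big1 ?g0// => s _; rewrite indicE memNset ?mulr0// => sw; apply: nw; exists s.
Qed.

End rademacher_expectation.

(** * Continuous functions with prescribed values at finitely many points *)

Section cantor_points.
Context (R : realType).

Let cK := cantor_space_compact.

Definition point_mass (t : nat) : cantor_space := fun k => k == t.

(** The indicator of the w that vanish at all the coordinates below t, as a product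
    so that continuity is immediate. *)
Fixpoint none_before (t : nat) (w : cantor_space) : R :=
  if t is t'.+1 then none_before t' w * (1 - (w t')%:R) else 1.

Definition first_at (t : nat) (w : cantor_space) : R := none_before t w * (w t)%:R.

Lemma continuous_coord (k : nat) : continuous (fun w : cantor_space => (w k)%:R : R).
Proof.
move=> w U wU.
have wk : nbhs w (@proj nat (fun=> bool) k @^-1` [set w k]).
  by apply: (@proj_continuous nat (fun=> bool) k w); exact/principal_filterP.
apply: (filterS _ wk) => w' w'k.
by have := nbhs_singleton wU; rewrite -(w'k : w' k = w k).
Qed.

Lemma continuous_none_before t : continuous (none_before t).
Proof.
elim: t => [|t IH] w /=; first exact: cvg_cst.
apply: cvgM; first exact: IH.
by apply: cvgB; [exact: cvg_cst|exact: continuous_coord].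
Qed.

Lemma continuous_first_at t : continuous (first_at t).
Proof.
by move=> w; apply: cvgM; [exact: continuous_none_before|exact: continuous_coord].
Qed.

Lemma none_before_ge0 t w : 0 <= none_before t w.
Proof. by elim: t => //= t IH; rewrite mulr_ge0// subr_ge0 lern1 leq_b1. Qed.

Lemma first_at_ge0 t w : 0 <= first_at t w.
Proof. by rewrite mulr_ge0 ?none_before_ge0. Qed.

(** The sets where the first nonzero coordinate is t are disjoint. *)
Lemma sum_first_at n w : \sum_(t < n) first_at t w = 1 - none_before n w.
Proof.
elim: n => [|n IH]; first by rewrite big_ord0 subrr.
by rewrite big_ord_recr/= IH /first_at; ring.
Qed.

Lemma none_before_point_mass t k : none_before t (point_mass k) = (t <= k)%:R.
Proof.
elim: t => //= t ->; rewrite /point_mass [(t < k)%N]ltn_neqAle.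
by case: (t == k) => /=; rewrite ?subrr ?mulr0 ?subr0 ?mulr1.
Qed.

Lemma first_at_point_mass t k : first_at t (point_mass k) = (t == k)%:R.
Proof.
rewrite /first_at none_before_point_mass /point_mass.
by case: eqP => [->|_]; rewrite ?leqnn ?mulr1 ?mulr0.
Qed.

Definition bump (t : nat) : CK R cK :=
  [the continuousType cantor_space R of mkcts (@continuous_first_at t)].

Lemma CK_sumE (I : Type) (r : seq I) (F : I -> CK R cK) (w : cantor_space) :
  (\sum_(i <- r) F i) w = \sum_(i <- r) F i w.
Proof. by elim/big_ind2: _ => // _ f _ g <- <-. Qed.

Lemma bump_comb_point (n : nat) (c : 'I_n -> R) (k : 'I_n) :
  (\sum_(t < n) c t *: bump t) (point_mass k) = c k.
Proof.
have E (t : 'I_n) : (c t *: bump t) (point_mass k) = c t * (val t == k)%:R.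
  by rewrite -first_at_point_mass.
rewrite CK_sumE (bigD1 k)//= big1 ?addr0 => [|t tk]; rewrite E ?eqxx ?mulr1//.
by rewrite (negbTE (tk : val t != val k)) mulr0.
Qed.

Lemma bump_comb_norm (n : nat) (c : 'I_n -> R) (m : R) : 0 <= m ->
  (forall t, `|c t| <= m) -> `|\sum_(t < n) c t *: bump t| <= m.
Proof.
move=> m0 cm; apply: CK_norm_le => // w; rewrite CK_sumE.
apply: (@le_trans _ _ (\sum_(t < n) m * first_at t w)).
  apply: le_trans (ler_norm_sum _ _ _) _; apply: ler_sum => t _.
  by rewrite [X in `|X|]/(c t * first_at t w) normrM (ger0_norm (first_at_ge0 _ _))
    ler_wpM2r ?first_at_ge0.
rewrite -mulr_sumr sum_first_at ler_piMr// lerBlDr lerDl; exact: none_before_ge0.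
Qed.

End cantor_points.

(** * The operator *)

Section block_operator.
Context (R : realType) (N : nat -> nat) (a : nat -> R).
Hypothesis a0 : forall n, 0 <= a n.
Hypothesis a1 : forall n, a n <= 1.

Let cK := cantor_space_compact.

Definition block_index := {n : nat & {v : 'I_(N n).+1 -> R | weak_l2 v}}.

(** Pairings of the values of f at the first N n + 1 point masses with all weights
    of weak L_2, so that the supremum norm of the image is the supremum over n of
    a n times the Lorentz norms of these samples. *)
Definition block_value (f : CK R cK) (j : block_index) : R :=
  a (tag j) * \sum_(t < (N (tag j)).+1) f (point_mass t) * sval (tagged j) t.

Lemma block_value_bounded f : block_value f \in @linf_pred R block_index.
Proof.
rewrite inE; exists `|f| => -[n [v wv]]; rewrite /block_value/= normrM ger0_norm//.
apply: (@le_trans _ _ (1 * `|\sum_(t < (N n).+1) f (point_mass t) * v t|)); first exact: ler_wpM2r.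
rewrite mul1r (le_trans (ler_norm_sum _ _ _))//.
apply: (@le_trans _ _ (\sum_(t < (N n).+1) `|f| * `|v t|)).
  by apply: ler_sum => t _; rewrite normrM ler_wpM2r//; exact: CK_norm_ub.
by rewrite -mulr_sumr ler_piMr// weak_l2_sum_le1.
Qed.

Definition block_op (f : CK R cK) : linf R block_index := Linf (block_value_bounded f).

Lemma block_op_linear : linear block_op.
Proof.
move=> c f g; apply: val_inj; apply/funext => j.
transitivity (c * block_value f j + block_value g j) => //.
rewrite /block_value [c * (a _ * _)]mulrCA -mulrDr; congr (_ * _).
rewrite mulr_sumr -big_split/=.
apply: eq_bigr => t _.
by rewrite [(c *: f + g) _]/(c * f (point_mass t) + g (point_mass t)) mulrDl mulrA.
Qed.

HB.instance Definition _ := GRing.isLinear.Build R (CK R cK) (linf R block_index) _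
  block_op block_op_linear.

Hypothesis block_bound : forall n (I : finType) (x : 'I_(N n).+1 -> I -> R)
    (w : I -> 'I_(N n).+1 -> R) (B : {ffun I -> bool} -> R),
  (forall s, weak_l2 (w s)) -> (forall t s, `|rad (x t) s| <= B s) ->
  a n ^+ 2 * (\sum_s (\sum_t x t s * w s t) ^+ 2) <= 6 * (2^-1) ^+ n * smean B ^+ 2.

Lemma sum_geometric_le (M : nat) : \sum_(n < M) (2^-1) ^+ n <= 2 :> R.
Proof.
suff -> : \sum_(n < M) (2^-1) ^+ n = 2 - 2 * (2^-1) ^+ M :> R.
  by rewrite lerBlDr lerDl mulr_ge0// exprn_ge0// invr_ge0.
elim: M => [|M IH]; first by rewrite big_ord0 expr0; ring.
by rewrite big_ord_recr/= IH exprS; field.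
Qed.

(** For each s choose an index j s where x s almost attains its norm, and group the
    s by the block of j s; the bounds of the blocks form a geometric series. *)
Lemma block_op_sum_sqr_le (S : nat) (x : 'I_S -> CK R cK) :
  \sum_s `|block_op (x s)| ^+ 2 <=
  48 * smean (fun s : {ffun 'I_S -> bool} => `|\sum_i sgn R (s i) *: x i|) ^+ 2.
Proof.
set B := fun s : {ffun 'I_S -> bool} => _.
have j0 : block_index.
  by exists 0%N, (fun=> 0); exact: weak_l2_0.
have [j jP] := choice (fun s => linf_norm_half j0 (block_op (x s))).
have [M jM] : exists M, forall s, (tag (j s) < M)%N.
  exists (\max_s tag (j s)).+1 => s; rewrite ltnS.
  exact: (@leq_bigmax _ (fun s => tag (j s)) s).
(* On block n, the indices s whose j s lies elsewhere get the weight 0. *)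
have fibre n s : exists w : 'I_(N n).+1 -> R, weak_l2 w /\ (tag (j s) == n ->
    block_op (x s) (j s) = a n * \sum_(t < (N n).+1) x s (point_mass t) * w t).
  case: (j s) => k [v wv] /=; have [kn|kn] := eqVneq k n.
    by subst k; exists v.
  by exists (fun=> 0); split=> //; exact: weak_l2_0.
have key n : \sum_(s | tag (j s) == n) `|block_op (x s) (j s)| ^+ 2 <=
    6 * (2^-1) ^+ n * smean B ^+ 2.
  have [w wP] := choice (fibre n).
  apply: le_trans (@block_bound n _ (fun t s => x s (point_mass t)) w B _ _); last 2 first.
  - by move=> s; have [] := wP s.
  - move=> t s; apply: le_trans (CK_norm_ub _ (point_mass t)).
    by rewrite CK_sumE.
  rewrite mulr_sumr [leRHS](bigID (fun s => tag (j s) == n)).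
  apply: ler_wpDr; first by apply: sumr_ge0 => s _; rewrite mulr_ge0 ?sqr_ge0.
  apply: ler_sum => s js; have [_ /(_ js) ->] := wP s.
  by rewrite real_normK ?num_real// exprMn.
apply: (@le_trans _ _ (\sum_s 4 * `|block_op (x s) (j s)| ^+ 2)).
  apply: ler_sum => s _.
  apply: (@le_trans _ _ ((2 * `|block_op (x s) (j s)|) ^+ 2)).
    by rewrite lerXn2r ?nnegrE ?mulr_ge0//; exact: jP.
  by rewrite exprMn -natrX.
rewrite -mulr_sumr (_ : 48 = 4 * 12 :> R); last by rewrite -natrM.
rewrite -mulrA ler_pM2l// (partition_big (fun s => Ordinal (jM s)) predT)//=.
apply: (@le_trans _ _ (\sum_(n < M) 6 * (2^-1) ^+ n * smean B ^+ 2)).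
  by apply: ler_sum => n _; apply: le_trans (key n).
rewrite -mulr_suml -mulr_sumr ler_wpM2r ?sqr_ge0//.
by have := sum_geometric_le M; lra.
Qed.

Lemma block_op_cotype2 : has_cotype2 (block_op : {linear CK R cK -> linf R block_index}).
Proof.
exists 7 => d Omega P eps rad_eps S x.
set E := 'E_P[_]%E.
have smE : ((smean (fun s : {ffun 'I_S -> bool} => `|\sum_i sgn R (s i) *: x i|))%:E <= E)%E.
  apply: (smean_le_expectation rad_eps) => // w s ws.
  rewrite le_eqVlt; apply/orP; left; apply/eqP; congr (`|_|).
  by apply: eq_bigr => i _; rewrite ws.
apply: (@le_trans _ _ (7%:E *
    (smean (fun s : {ffun 'I_S -> bool} => `|\sum_i sgn R (s i) *: x i|))%:E)%E).
  rewrite -EFinM lee_fin; set m := smean _.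
  have m0 : 0 <= m by exact: smean_ge0.
  have -> : 7 * m = Num.sqrt ((7 * m) ^+ 2) by rewrite sqrtr_sqr ger0_norm// mulr_ge0.
  apply: ler_wsqrtr.
  apply: le_trans (block_op_sum_sqr_le x) _; rewrite [(7 * m) ^+ 2]exprMn.
  by rewrite ler_wpM2r ?sqr_ge0// -natrX ler_nat.
by apply: lee_wpmul2l smE; rewrite lee_fin.
Qed.

Hypothesis block_large : forall n, 2 ^+ n <= a n ^+ 2 * harm R (N n).+1.

(** On one block, [little_grothendieck] bounds the square sum of the norms of the
    translates [rot_test] by a constant times h = harm (N n).+1, the value of their
    square function. Each of these N n + 1 functions pairs with [rot_weight] to
    h / (2 sqrt (N n + 1)), so the square sum is at least a n ^ 2 * h ^ 2 / 4, which is
    impossible for large n. *)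
Lemma block_op_not_hilbert :
  ~ factors_through_hilbert (block_op : {linear CK R cK -> linf R block_index}).
Proof.
move=> [H [A [B [hilH [MA bA] [MB bB] TE]]]].
have bnd n : 2 ^+ n <= 4 * MB ^+ 2 * (48 * MA ^+ 2 + 1).
  apply: le_trans (block_large n) _.
  pose h : R := harm R (N n).+1.
  have h0 : 0 < h by rewrite (lt_le_trans _ (harm_ge1 R (N n))).
  pose x := @rot_test R (N n).
  pose F s : CK R cK := \sum_t x t s *: bump R t.
  have AF s : A (F s) = \sum_t x t s *: A (bump R t).
    by rewrite linear_sum; apply: eq_bigr => t _; rewrite linearZ.
  have lg : \sum_s `|A (F s)| ^+ 2 <= (48 * MA ^+ 2 + 1) * h.
    under eq_bigr do rewrite AF.
    rewrite -[MA ^+ 2]real_normK ?num_real//.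
    apply: (@little_grothendieck R H _ (fun t : 'I_(N n).+1 => A (bump R t)) `|MA| hilH
      (normr_ge0 _) _ _ x h h0) => [c m m0 cm|t].
      have -> : \sum_t c t *: A (bump R t) = A (\sum_t c t *: bump R t).
        by rewrite linear_sum; apply: eq_bigr => t _; rewrite linearZ.
      apply: le_trans (bA _) _; apply: le_trans (_ : `|MA| * `|\sum_t c t *: bump R t| <= _).
        by rewrite ler_wpM2r// ler_norm.
      by rewrite ler_wpM2l// bump_comb_norm.
    by rewrite sqn_rot_test.
  have sN : 0 < (N n).+1%:R :> R by rewrite ltr0n.
  have low s : (a n * (h / (2 * Num.sqrt (N n).+1%:R))) ^+ 2 <= MB ^+ 2 * `|A (F s)| ^+ 2.
    pose j : block_index := existT _ n (exist _ _ (@weak_l2_rot_weight R (N n) s)).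
    have jE : block_op (F s) j = a n * (h / (2 * Num.sqrt (N n).+1%:R)).
      rewrite /= /block_value/= -(@rot_pairing R (N n) s); congr (_ * _).
      by apply: eq_bigr => t _; rewrite bump_comb_point.
    rewrite -jE -[leLHS]real_normK ?num_real// -exprMn -[leRHS]real_normK ?num_real//.
    rewrite lerXn2r ?nnegrE//.
    apply: (@le_trans _ _ `|block_op (F s)|); first exact: linf_norm_ub.
    rewrite [block_op (F s)]TE (le_trans (bB _))// normrM normr_id.
    by apply: ler_wpM2r => //; exact: ler_norm.
  have : (N n).+1%:R * (a n * (h / (2 * Num.sqrt (N n).+1%:R))) ^+ 2 <=
      MB ^+ 2 * ((48 * MA ^+ 2 + 1) * h).
    apply: (@le_trans _ _ (\sum_s MB ^+ 2 * `|A (F s)| ^+ 2)).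
      rewrite mulr_natl -[X in _ *+ X]card_ord -sumr_const.
      exact: ler_sum.
    by rewrite -mulr_sumr ler_wpM2l ?sqr_ge0.
  rewrite !exprMn exprVn exprMn sqr_sqrtr// => lg2.
  rewrite -(ler_pM2r h0) -/h; move: lg2.
  set D := (N n).+1%:R in sN *.
  have -> : D * (a n ^+ 2 * (h ^+ 2 * (2 ^+ 2 * D)^-1)) = a n ^+ 2 * h * h / 4.
    by field; rewrite gt_eqF.
  lra.
have := truncnS_gt (4 * MB ^+ 2 * (48 * MA ^+ 2 + 1)); set k := (Num.truncn _).+1.
move=> /(le_lt_trans (bnd k)); rewrite -natrX ltr_nat ltnNge => /negP; apply.
exact/ltnW/ltn_expl.
Qed.

End block_operator.

(** * Choice of the blocks *)

Section block_parameters.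
Context (R : realType).

Lemma harm_unbounded (M : R) : exists n, M <= harm R n.+1.
Proof.
apply: contrapT => nM.
have hM n : harm R n <= M.
  have : harm R n.+1 < M by rewrite ltNge; apply/negP => h; apply: nM; exists n.
  move=> /ltW; apply: le_trans.
  by rewrite /harm big_ord_recr/= lerDl invr_ge0.
apply: (@dvg_harmonic R); apply: nondecreasing_is_cvgn.
  apply/nondecreasing_seqP => n; rewrite /series/= big_nat_recr//= lerDl.
  exact: harmonic_ge0.
by exists M => _ [n _ <-]; rewrite /series/= big_mkord; exact: hM.
Qed.

(** With u = 2 ^ - n, take N so large that h = harm N.+1 is at least 4 ^ n times the
    constant F of [block_cotype]; then u^2 h + F <= 2 * 4 ^ - n * h, and the weight
    a n = sqrt (2 ^ n / h) leaves the factor 2 ^ - n for cotype while a n ^ 2 * h is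
    unbounded. *)
Lemma block_parameters : exists (N : nat -> nat) (a : nat -> R), forall n,
  [/\ 0 <= a n, a n <= 1, 2 ^+ n <= a n ^+ 2 * harm R (N n).+1 &
    forall (I : finType) (x : 'I_(N n).+1 -> I -> R)
      (w : I -> 'I_(N n).+1 -> R) (B : {ffun I -> bool} -> R),
    (forall s, weak_l2 (w s)) -> (forall t s, `|rad (x t) s| <= B s) ->
    a n ^+ 2 * (\sum_s (\sum_t x t s * w s t) ^+ 2) <= 6 * (2^-1) ^+ n * smean B ^+ 2].
Proof.
suff /choice[Na NaP] : forall n, exists Na : nat * R,
    [/\ 0 <= Na.2, Na.2 <= 1, 2 ^+ n <= Na.2 ^+ 2 * harm R Na.1.+1 &
    forall (I : finType) (x : 'I_Na.1.+1 -> I -> R)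
      (w : I -> 'I_Na.1.+1 -> R) (B : {ffun I -> bool} -> R),
    (forall s, weak_l2 (w s)) -> (forall t s, `|rad (x t) s| <= B s) ->
    Na.2 ^+ 2 * (\sum_s (\sum_t x t s * w s t) ^+ 2) <= 6 * (2^-1) ^+ n * smean B ^+ 2].
  by exists (fun n => (Na n).1), (fun n => (Na n).2).
move=> n; pose u : R := (2^-1) ^+ n.
have u0 : 0 < u by rewrite exprn_gt0// invr_gt0.
have u1 : u <= 1 by rewrite exprn_ile1// ?invr_ge0// invf_le1// ler1n.
have [F F1 blk] := block_cotype u0 u1.
have pu : 2 ^+ n * u = 1 by rewrite -exprMn mulfV// expr1n.
have p1 : 1 <= 2 ^+ n :> R by rewrite exprn_ege1// ler1n.
have [N hN] := harm_unbounded (2 ^+ n * 2 ^+ n * F).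
set h := harm R N.+1 in hN *.
have ph : 2 ^+ n <= h by apply: le_trans hN; rewrite -mulrA ler_peMr// mulr_ege1.
have h0 : 0 < h by rewrite (lt_le_trans _ ph)// (lt_le_trans _ p1).
have hn0 : h != 0 by rewrite gt_eqF.
have p0 : 0 <= 2 ^+ n / h by rewrite divr_ge0// ltW// (lt_le_trans _ p1).
exists (N, Num.sqrt (2 ^+ n / h)) => /=; rewrite sqr_sqrtr//; split.
- exact: sqrtr_ge0.
- by rewrite -[leRHS]sqrtr1 ler_wsqrtr// ler_pdivrMr// mul1r.
- by rewrite -/h divfK.
move=> I x w B ww xB.
have T0 : (0 < #|'I_N.+1|)%N by rewrite card_ord.
have := @blk I _ x w B T0 ww xB; rewrite card_ord -/h => bnd.
apply: le_trans (ler_wpM2l p0 bnd) _; rewrite mulrA ler_wpM2r ?sqr_ge0//.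
rewrite mulrAC ler_pdivrMr// -/u.
have hF : F <= u ^+ 2 * h.
  have : u ^+ 2 * (2 ^+ n * 2 ^+ n * F) <= u ^+ 2 * h by rewrite ler_pM2l// exprn_gt0.
  apply: le_trans; rewrite (_ : _ * _ = (2 ^+ n * u) ^+ 2 * F); last by ring.
  by rewrite pu expr1n mul1r.
apply: (@le_trans _ _ (2 ^+ n * (3 * (u ^+ 2 * h + u ^+ 2 * h)))).
  by rewrite ler_pM2l ?(lt_le_trans _ p1)// ler_pM2l// lerD2l.
rewrite (_ : _ * _ = 6 * (2 ^+ n * u) * u * h); last by ring.
by rewrite pu mulr1.
Qed.

End block_parameters.

Theorem mainTheorem2 (R : realType) :
  exists (K : topologicalType) (cK : compact [set: K])
         (Y : completeNormedModType R) (T : {linear CK R cK -> Y}),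
    [/\ hausdorff_space K, has_cotype2 T & ~ factors_through_hilbert T].
Proof.
have [N [a Na]] := block_parameters R.
have a0 n : 0 <= a n by have [] := Na n.
have a1 n : a n <= 1 by have [] := Na n.
exists cantor_space, cantor_space_compact, (linf R (block_index R N)),
  (block_op N a0 a1); split.
- exact: cantor_space_hausdorff.
- by apply: block_op_cotype2 => n; have [] := Na n.
- by apply: block_op_not_hilbert => n; have [] := Na n.
Qed.
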